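(* Let $\alpha\le\alpha_0=\frac{13-3\sqrt{17}}{4}$. Let $$r_0=\frac{1+\alpha-\sqrt{1-6\alpha+\alpha^2}}{4\alpha}\quad\text{and}\quad r_1=\frac{1-3\alpha-\sqrt{1-6\alpha+\alpha^2}}{4\alpha}.$$ If $\mathbf x_0\in\mathscr M$ satisfies $\frac12\,\beta(\mathbf f,\mathbf x_0)\,\mu(\mathbf f,\mathbf x_0)\,\nu(\mathbf x_0)\le\alpha$, then the sequence defined recursively by $\mathbf x_{i+1}=\mathbf x_0+\mathbf N_{\mathbf f,\mathbf x_0}(\mathbf x_i-\mathbf x_0)$ is well-defined and converges to a zero $\boldsymbol\zeta\in\mathscr M$ of $\mathbf f$. Furthermore, (a) $\|\mathbf x_i-\boldsymbol\zeta\|_{\mathbf x_0}\le2^{-2^i+1}\|\mathbf x_1-\mathbf x_0\|_{\mathbf x_0}$; (b) $\|\mathbf x_i-\boldsymbol\zeta\|_{\boldsymbol\zeta}\le2^{-2^i+1}\|\mathbf x_1-\mathbf x_0\|_{\mathbf x_0}$; (c) $\|\mathbf x_0-\boldsymbol\zeta\|_{\mathbf x_0}\le r_0\,\beta(\mathbf f,\mathbf x_0)$; (d) $\|\mathbf x_1-\boldsymbol\zeta\|_{\boldsymbol\zeta}\le r_1\,\beta(\mathbf f,\mathbf x_0)$.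
   Context: Spaces. Fix $n\ge1$, finite nonempty sets $A_1,\dots,A_n\subset(\mathbb R^n)^*$ (row vectors), and $\rho_{i,\mathbf a}>0$ for $\mathbf a\in A_i$. $\mathscr F_i$ is the space of exponential sums $f_i(\mathbf x)=\sum_{\mathbf a\in A_i}f_{i,\mathbf a}\rho_{i,\mathbf a}e^{\mathbf a\mathbf x}$ on $\mathbb C^n$, with $(\rho_{i,\mathbf a}e^{\mathbf a\mathbf x})_{\mathbf a\in A_i}$ orthonormal, so $\|f_i\|^2=\sum_{\mathbf a}|f_{i,\mathbf a}|^2$. $V_i(\mathbf x)\in\mathscr F_i^*$ is evaluation at $\mathbf x$; in dual coordinates $V_i(\mathbf x)=(\rho_{i,\mathbf a}e^{\mathbf a\mathbf x})_{\mathbf a}$ and $\|V_i(\mathbf x)\|^2=K_i(\mathbf x,\mathbf x)=\sum_{\mathbf a}\rho_{i,\mathbf a}^2e^{2\mathbf a\,\mathrm{Re}(\mathbf x)}$. Let $[V]=([V_1],\dots,[V_n]):\mathbb C^n\to\mathbb P(\mathscr F_1^* )\times\cdots\times\mathbb P(\mathscr F_n^* )$, and let $\mathscr M=\mathbb C^n/[V]$ be the quotient identifying points of $\mathbb C^n$ with the same image under $[V]$. Points of $\mathscr M$ are handled through representatives in $\mathbb C^n$; sums and differences are those of $\mathbb C^n$, and in an expression such as $\|\mathbf x-\mathbf z\|_{\mathbf x}$ the representatives are chosen to minimize the norm. $\mathbf f=(f_1,\dots,f_n)$ with each $f_i\in\mathscr F_i\setminus\{0\}$; a zero of $\mathbf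 f$ is a point where all $f_i$ vanish. Momentum and local norms. $\mathbf m_i(\mathbf x)=\frac12D\log K_i(\mathbf x,\mathbf x)=\sum_{\mathbf a}p_{i,\mathbf a}(\mathbf x)\,\mathbf a$ with $p_{i,\mathbf a}(\mathbf x)=\rho_{i,\mathbf a}^2e^{2\mathbf a\mathrm{Re}(\mathbf x)}/K_i(\mathbf x,\mathbf x)$. $\langle\cdot,\cdot\rangle_{i,\mathbf x}$ is the pull-back by $[V_i]$ of the Fubini–Study metric: $\|\mathbf u\|_{i,\mathbf x}^2=\sum_{\mathbf a}p_{i,\mathbf a}(\mathbf x)|(\mathbf a-\mathbf m_i(\mathbf x))\mathbf u|^2$; $\|\mathbf u\|_{\mathbf x}^2=\sum_{i=1}^n\|\mathbf u\|_{i,\mathbf x}^2$. $T_{\mathbf x}\mathscr M$ is $\mathbb C^n$ (modulo the common kernel of these seminorms, which is $0$ when $DS_{\mathbf f,\mathbf x}(0)$ below is invertible). Newton operators. $S_{\mathbf f,\mathbf x}(\dot{\mathbf x})\in\mathbb C^n$ has $i$-th coordinate $\|W_i(\mathbf x)\|^{-1}W_i(\mathbf x+\dot{\mathbf x})(f_i)$, where $W_i(\mathbf y)=e^{-\mathbf m_i(\mathbf x)\mathbf y}V_i(\mathbf y)$ ($\mathbf x$ fixed), so $W_i(\mathbf y)(f_i)=e^{-\mathbf m_i(\mathbf x)\mathbf y}f_i(\mathbf y)$. The local Newton operator at $\mathbf x$ is $\mathbf N_{\mathbf f,\mathbf x}(\dot{\mathbf x})=\dot{\mathbf x}-DS_{\mathbf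 f,\mathbf x}(\dot{\mathbf x})^{-1}S_{\mathbf f,\mathbf x}(\dot{\mathbf x})$, $\dot{\mathbf x}\in T_{\mathbf x}\mathscr M$. Invariants. $\beta(\mathbf f,\mathbf x)=\|DS_{\mathbf f,\mathbf x}(0)^{-1}S_{\mathbf f,\mathbf x}(0)\|_{\mathbf x}$. $\mu(\mathbf f,\mathbf x)=\|DS_{\mathbf f,\mathbf x}(0)^{-1}\,\mathrm{diag}(\|f_1\|,\dots,\|f_n\|)\|_{\mathbf x}$, operator norm from $\mathbb C^n$ (canonical norm) to $(T_{\mathbf x}\mathscr M,\|\cdot\|_{\mathbf x})$. $\nu(\mathbf x)=\max_i\max_{\mathbf a\in A_i}\sup_{\|\mathbf u\|_{i,\mathbf x}\le1}|(\mathbf a-\mathbf m_i(\mathbf x))\mathbf u|$. If $DS_{\mathbf f,\mathbf x}(0)$ is not invertible, $\beta=\mu=\infty$.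
   Formalization: Inequalities (a) and (b) are stated for i ≥ 1, since at i = 0 both fail (for (a): n=1, f=e^x−c, c>1 near 1, x_0=0); finiteness of β(f,x_0) is assumed explicitly, to exclude the undefined product ∞·0 when ν(x_0)=0. *)

(* Defs.v *)
From HB Require Import structures.
From mathcomp Require Import all_boot all_order all_algebra finmap.
From mathcomp Require Import generic_quotient.
From mathcomp Require Import all_classical all_reals all_analysis.
From mathcomp Require Import complex.

Set Implicit Arguments.
Unset Strict Implicit.
Unset Printing Implicit Defensive.

Import Order.TTheory GRing.Theory Num.Theory.
Import numFieldNormedType.Exports.

Local Open Scope classical_set_scope.
Local Open Scope ring_scope.
Local Open Scope complex_scope.

(* Points of C^n are columns, exponents are real rows; the i-th coordinate of
   a system is indexed by i : 'I_n, and the coordinates of F_i by A i. *)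

Section ComplexTools.
Variable R : realType.

(* C carries the topology of its modulus *)
HB.instance Definition _ :=
  NormedModule.copy R[i] ((R[i] : numFieldType)^o)%type.

Definition cexp (z : R[i]) : R[i] :=
  Complex (expR (complex.Re z) * cos (complex.Im z))
          (expR (complex.Re z) * sin (complex.Im z)).

Definition pairing n (a : 'rV[R]_n) (u : 'cV[R[i]]_n) : R[i] :=
  (map_mx (real_complex R) a *m u) 0 0.

Definition cabs2 (z : R[i]) : R := complex.Re z ^+ 2 + complex.Im z ^+ 2.

Definition norm2 n (v : 'cV[R[i]]_n) : R := Num.sqrt (\sum_i cabs2 (v i 0)).

End ComplexTools.

Section Systems.
Variables (R : realType) (n : nat) (A : 'I_n -> {fset 'rV[R]_n}).
Variable rho : forall i, A i -> R.

Local Notation C := R[i].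
Local Notation Cn := 'cV[R[i]]_n.

Definition evalV i (x : Cn) (a : A i) : C :=
  real_complex R (rho a) * cexp (pairing (val a) x).

Definition projeq (x y : Cn) : Prop :=
  forall i, exists2 c : C, c != 0 & forall a : A i, evalV x a = c * evalV y a.

Lemma projeq_refl x : projeq x x.
Proof. by move=> i; exists 1; rewrite ?oner_neq0// => a; rewrite mul1r. Qed.

Lemma projeq_sym x y : projeq x y -> projeq y x.
Proof.
move=> xy i; have [c c0 xE] := xy i; exists c^-1; rewrite ?invr_eq0// => a.
by rewrite xE mulKf.
Qed.

Lemma projeq_trans x y z : projeq x y -> projeq y z -> projeq x z.
Proof.
move=> xy yz i; have [c c0 xE] := xy i; have [d d0 yE] := yz i.
by exists (c * d); rewrite ?mulf_neq0// => a; rewrite xE yE mulrA.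
Qed.

Definition projeqb : rel Cn := fun x y => `[< projeq x y >].

Lemma projeqb_equiv : equiv_class_of projeqb.
Proof.
split=> [x|x y|y x z].
- exact/asboolP/projeq_refl.
- by apply/asboolP/asboolP; exact: projeq_sym.
- by move=> /asboolP xy /asboolP yz; exact/asboolP/(projeq_trans xy).
Qed.

Canonical projeq_equiv := EquivRelPack projeqb_equiv.

Definition toric_manifold : Type :=
  quotient_topology {eq_quot projeq_equiv}%qT.
HB.instance Definition _ := Quotient.copy toric_manifold
  (quotient_topology {eq_quot projeq_equiv}%qT).
HB.instance Definition _ := Topological.copy toric_manifold
  (quotient_topology {eq_quot projeq_equiv}%qT).

Definition toric_pi (x : Cn) : toric_manifold := (\pi_toric_manifold x)%qT.

Lemma toric_piP x y : toric_pi x = toric_pi y <-> projeq x y.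
Proof.
have h := @eqquotP _ _ {eq_quot projeq_equiv}%qT x y.
by split=> [/h/asboolP|/asboolP/h].
Qed.

(* K_i(x,x) = |V_i(x)|^2; Re(a x) = a Re(x) because a is real *)
Definition kerK i (x : Cn) : R :=
  \sum_(a : A i) rho a ^+ 2 * expR (2 * complex.Re (pairing (val a) x)).

Definition weight i (x : Cn) (a : A i) : R :=
  rho a ^+ 2 * expR (2 * complex.Re (pairing (val a) x)) / kerK i x.

(* one half of D log K_i(x,x) *)
Definition momentum i (x : Cn) : 'rV[R]_n :=
  \sum_(a : A i) weight x a *: val a.

(* pull-back of the Fubini-Study norm by [V_i]; only a seminorm in general *)
Definition lnormi i (x u : Cn) : R :=
  Num.sqrt (\sum_(a : A i)
    weight x a * cabs2 (pairing (val a - momentum i x) u)).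

Definition lnorm (x u : Cn) : R := Num.sqrt (\sum_i lnormi i x u ^+ 2).

(* |y - z|_x for y, z in the quotient: the least value over representatives *)
Definition ldist (x y z : Cn) : R :=
  inf [set r | exists y' z', [/\ projeq y' y, projeq z' z &
                              r = lnorm x (y' - z')]].

Definition evalW i (x y : Cn) (a : A i) : C :=
  cexp (- pairing (momentum i x) y) * evalV y a.

Definition normW i (x : Cn) : R := Num.sqrt (\sum_(a : A i) cabs2 (evalW x x a)).

Definition system := forall i, {ffun A i -> C}.

Definition sys_eval (f : system) i (x : Cn) : C :=
  \sum_(a : A i) f i a * evalV x a.

Definition is_zero (f : system) (x : Cn) : Prop := forall i, sys_eval f i x = 0.

Definition coef_norm (f : system) i : R :=
  Num.sqrt (\sum_(a : A i) cabs2 (f i a)).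

Definition newtS (f : system) (x u : Cn) : Cn :=
  \col_i (real_complex R (normW i x)^-1 *
          \sum_(a : A i) f i a * evalW x (x + u) a).

(* matrix of the complex Frechet derivative of newtS f x at u *)
Definition newtDS (f : system) (x u : Cn) : 'M[C]_n :=
  \matrix_(i, j) ('d (newtS f x) u (delta_mx j 0 : Cn) : Cn) i 0.

(* meaningful only where newtDS f x u is invertible: invmx is the identity on
   singular matrices *)
Definition newton (f : system) (x u : Cn) : Cn :=
  u - invmx (newtDS f x u) *m newtS f x u.

Fixpoint newton_seq (f : system) (x0 : Cn) (k : nat) : Cn :=
  if k is k'.+1 then x0 + newton f x0 (newton_seq f x0 k' - x0) else x0.

(* beta and mu are +oo where DS is singular.  In \bar R, +oo * 0 = 0, so a
   finite bound on beta * mu * nu does not by itself force beta to be finite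
   (nu x = 0 when every A i is a singleton). *)
Definition beta (f : system) (x : Cn) : \bar R :=
  if newtDS f x 0 \in unitmx
  then (lnorm x (invmx (newtDS f x 0) *m newtS f x 0))%:E else +oo%E.

Definition mu (f : system) (x : Cn) : \bar R :=
  if newtDS f x 0 \in unitmx
  then ereal_sup [set (lnorm x (invmx (newtDS f x 0) *m
         diag_mx (\row_i real_complex R (coef_norm f i)) *m v))%:E |
         v in [set v : Cn | norm2 v <= 1]]
  else +oo%E.

Definition nu (x : Cn) : \bar R :=
  \big[maxe/-oo%E]_(i < n) \big[maxe/-oo%E]_(a : A i)
    ereal_sup [set (Num.sqrt (cabs2 (pairing (val a - momentum i x) u)))%:E |
               u in [set u : Cn | lnormi i x u <= 1]].

End Systems.

(* Main.v *)
Require Import Defs.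
From HB Require Import structures.
From mathcomp Require Import all_boot all_order all_algebra finmap.
From mathcomp Require Import generic_quotient.
From mathcomp Require Import all_classical all_reals all_analysis.
From mathcomp Require Import complex.
From mathcomp Require Import ring lra.

Set Implicit Arguments.
Unset Strict Implicit.
Unset Printing Implicit Defensive.

Import Order.TTheory GRing.Theory Num.Theory.
Import numFieldNormedType.Exports.
Import ComplexField.Normc.

Local Open Scope classical_set_scope.
Local Open Scope ring_scope.
Local Open Scope complex_scope.

(** At the base point [x0], write [z_a(u) = (a - m_i(x0)) u]. After the
preconditioning by [DS(0)^-1] the system becomes [Phi (e^z(u)) = 0], where [Phi]
is a linear map from families of coefficients to [C^n] with [Phi (z(w)) = w],
of norm at most [mu] from the weighted l2 norm (weights [p_a]) to the norm at
[x0], and [|z_a(w)| <= nu |w|]. The bound [e^r - 1 - r <= 3 r^2 / (2 (3 - r))] for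
the exponential makes the simplified Newton map a contraction of a ball of
radius [theta beta], which yields the zero [zeta = x0 + u] and (c); Newton's
method then contracts quadratically in that ball. The norm at [zeta] exceeds the
norm at [x0] by a factor at most [e^(nu |u|)], which leaves room enough for (b).

For (d) that factor is too large. Put [V = z(x1 - zeta)] and [eta = (e^z - 1 - z)/z]
at [z = z(u)]; since [u] is a zero, [Phi ((1 + eta) V) = Phi (eta z(x1 - x0))]. If
[e] is the average of [Re eta] with respect to [|V|^2], then [2 e V - eta V] is the
reflection of [eta V] in the real line of [V] and has the same norm, hence
[(1 + 2 e) |V| <= mu |eta| (beta + |V|)]: the error is small precisely when the
metric grows along it, because the square of the norm at [zeta] is at most
[(A + 4 e) |V|^2] with [A = 1 + O(nu^2 |u|^2)]. *)

(** [r0] is the smallest root of [theta = 1 + alpha theta^2 / (1 - alpha theta)], the majorant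
    equation that the geometric bound [r^2 / (2 - r)] for [e^r - 1 - r] would give. The Pade bound
    has ratio 1/3 in place of 1/2, and the gap between the two roots is all the room there is for a
    change of base point. It is small: as [alpha] tends to 0, [r1 = alpha + 3 alpha^2 + ...] and
    [theta - 1 = alpha + (8/3) alpha^2 + ...], with quotient [1 + alpha/3 + ...], whereas
    [e^(2 alpha theta) = 1 + 2 alpha + ...]. Hence (d) tolerates no first-order loss in the metric
    at [zeta]. Since [Phi (z(w)) = w], [mu] is at least 1 when [beta > 0], and functions growing at
    least linearly absorb it; so all estimates reduce to [beta mu nu], hence to [T = 2 alpha theta].
    The quotient matters only through periods: upper bounds use the representatives at hand, and the
    one lower bound required is that of the distance from [x1] to [x0]. When [beta = 0] the
    hypothesis says nothing on [mu] and [nu]; the sequence is then constant. *)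

Section ComplexExponential.
Variable R : realType.
Local Notation C := R[i].
Implicit Types (z w : C) (r s : R).

Lemma normc_cabs2 z : normc z = Num.sqrt (cabs2 z).
Proof. by case: z. Qed.

Lemma cabs2E z : cabs2 z = normc z ^+ 2.
Proof. by rewrite normc_cabs2 sqr_sqrtr// addr_ge0// sqr_ge0. Qed.

Lemma normc_ge0 z : 0 <= normc z.
Proof. by rewrite normc_cabs2 sqrtr_ge0. Qed.

Lemma Re_addc z w : complex.Re (z + w) = complex.Re z + complex.Re w.
Proof. by case: z; case: w. Qed.

Lemma Im_addc z w : complex.Im (z + w) = complex.Im z + complex.Im w.
Proof. by case: z; case: w. Qed.

Lemma Re_oppc z : complex.Re (- z) = - complex.Re z.
Proof. by case: z. Qed.

Lemma Im_oppc z : complex.Im (- z) = - complex.Im z.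
Proof. by case: z. Qed.

Lemma Re_mulc z w : complex.Re (z * w) =
  complex.Re z * complex.Re w - complex.Im z * complex.Im w.
Proof. by case: z; case: w. Qed.

Lemma Im_mulc z w : complex.Im (z * w) =
  complex.Re z * complex.Im w + complex.Im z * complex.Re w.
Proof. by case: z; case: w. Qed.

Lemma normr_Re z : `|complex.Re z| <= normc z.
Proof.
by rewrite normc_cabs2 -sqrtr_sqr ler_wsqrtr// lerDl sqr_ge0.
Qed.

Lemma normr_Im z : `|complex.Im z| <= normc z.
Proof.
by rewrite normc_cabs2 -sqrtr_sqr ler_wsqrtr// lerDr sqr_ge0.
Qed.

Lemma normc_real r : normc (r%:C : C) = `|r|.
Proof. by rewrite /= expr0n addr0 sqrtr_sqr. Qed.

Lemma normc_sum (I : finType) (F : I -> C) :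
  normc (\sum_i F i) <= \sum_i normc (F i).
Proof.
elim/big_ind2 : _ => [|u1 x1 u2 x2 le1 le2|//]; first by rewrite normc0.
by apply: (le_trans (le_normcD _ _)); exact: lerD.
Qed.

Lemma cexpD z w : cexp (z + w) = cexp z * cexp w.
Proof.
case: z w => [a b] [c d]; apply/eqP; rewrite eq_complex /= expRD cosD sinD.
by apply/andP; split; apply/eqP; ring.
Qed.

Lemma cexp0 : cexp (0 : C) = 1.
Proof.
by apply/eqP; rewrite eq_complex /= expR0 cos0 sin0 mulr0 mulr1 !eqxx.
Qed.

Lemma normc_cexp z : normc (cexp z) = expR (complex.Re z).
Proof.
by rewrite normc_cabs2 /cabs2 /= !exprMn -mulrDr cos2Dsin2 mulr1 sqrtr_sqr ger0_norm.
Qed.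

Lemma cexp_neq0 z : cexp z != 0.
Proof.
apply/eqP => e0; have := normc_cexp z; rewrite e0 normc0 => /eqP.
by rewrite eq_sym gt_eqF// expR_gt0.
Qed.

(** The periods of the exponential are isolated; the gap 2 is cruder than the true value [2 pi] but
    follows from [pi_ge2] and the positivity of [sin] on [(0, pi)]. *)
Lemma cexp_eq1 z : cexp z = 1 -> z = 0 \/ 2 <= normc z.
Proof.
move=> e1; have := normc_cexp z; rewrite e1 normc1.
rewrite -{1}expR0 => /expR_inj/esym Rz.
have [/eqP Iz|Iz0] := boolP (complex.Im z == 0).
  by left; apply/eqP; rewrite eq_complex Rz Iz !eqxx.
right; apply: (le_trans _ (normr_Im z)); rewrite leNgt; apply/negP => I2.
have sinz : sin (complex.Im z) = 0.
  have /(congr1 (@complex.Im R)) := e1.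
  by rewrite /cexp /= Rz expR0 mul1r.
have : sin `|complex.Im z| != 0.
  apply: lt0r_neq0; apply: sin_gt0_pi.
  by rewrite normr_gt0 Iz0 (lt_le_trans I2)// pi_ge2.
by have [/ger0_norm|/ltr0_norm] := lerP 0 (complex.Im z) => ->;
  rewrite ?sinN sinz ?oppr0 eqxx.
Qed.

Lemma is_derive_scale (c s d : R) (f : R -> R) : is_derive s 1 f d ->
  is_derive s 1 (fun r => c * f r) (c * d).
Proof. by move=> fd; exact: (is_deriveZ c fd). Qed.

Lemma is_derive_mul (s c d : R) (f g : R -> R) : is_derive s 1 f c ->
  is_derive s 1 g d -> is_derive s 1 (fun r => f r * g r) (f s * d + g s * c).
Proof. by move=> fd gd; exact: (is_deriveM fd gd). Qed.

Lemma is_derive_exprn (s : R) k :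
  is_derive s 1 (fun r : R => r ^+ k) (k%:R * s ^+ k.-1).
Proof.
rewrite (_ : (fun r => _) = (@id R) ^+ k); last first.
  by apply/funext => r; rewrite !fctE.
by apply: is_derive_eq; exact: mulr1.
Qed.

Lemma ler_mean_value (f g df dg : R -> R) r : 0 <= r ->
  (forall s, is_derive s 1 f (df s)) -> (forall s, is_derive s 1 g (dg s)) ->
  (forall s, 0 <= s <= r -> df s <= dg s) ->
  f r - f 0 <= g r - g 0.
Proof.
move=> r0 fd gd le_d.
have D s : is_derive s 1 (g - f) (dg s - df s) by exact: is_deriveB.
have [|c cI] := @MVT_segment R (g - f) (fun s => dg s - df s) 0 r r0.
  apply: derivable_within_continuous => s _.
  exact: ex_derive.
rewrite subr0 => E.
have : 0 <= (g - f) r - (g - f) 0.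
  by rewrite E mulr_ge0// subr_ge0 le_d//; move: cI; rewrite in_itv.
rewrite !fctE; lra.
Qed.

(** Differentiation in a real variable, by components: it is used along segments, where the real
    mean value theorem applies. *)
Definition is_cderive s (f : R -> C) (d : C) :=
  is_derive s 1 (fun r => complex.Re (f r)) (complex.Re d) /\
  is_derive s 1 (fun r => complex.Im (f r)) (complex.Im d).

(** Projecting the curve on the direction of its increment [w] reduces to the real inequality: the
    increment of the projection is [|w|^2], and one factor [|w|] cancels. *)
Lemma normc_mean_value (f df : R -> C) (g dg : R -> R) :
  (forall s, is_cderive s f (df s)) -> (forall s, is_derive s 1 g (dg s)) ->
  (forall s, 0 <= s <= 1 -> normc (df s) <= dg s) ->
  normc (f 1 - f 0) <= g 1 - g 0.
Proof.
move=> fd gd le_d.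
have g10 : 0 <= g 1 - g 0.
  have := @ler_mean_value (cst 0) g (cst 0) dg 1 ler01.
  rewrite /cst subrr; apply => // s s01.
  exact: le_trans (normc_ge0 _) (le_d _ s01).
set w := f 1 - f 0.
have [w0|w_neq0] := eqVneq (normc w) 0; first by rewrite w0.
have {w_neq0}w_gt0 : 0 < normc w by rewrite lt_def w_neq0 normc_ge0.
rewrite -(ler_pM2l w_gt0).
pose u r := complex.Re w * complex.Re (f r) + complex.Im w * complex.Im (f r).
have ->: normc w * normc w = u 1 - u 0.
  rewrite -expr2 -cabs2E /cabs2 /u /w !Re_addc !Im_addc !Re_oppc !Im_oppc.
  by ring.
rewrite mulrBr.
apply: (@ler_mean_value u (fun s => normc w * g s)
  (fun s => complex.Re w * complex.Re (df s) + complex.Im w * complex.Im (df s))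
  (fun s => normc w * dg s) 1 ler01) => [s|s s01].
- by have [Rd Id] := fd s; apply: is_deriveD; apply: is_derive_scale.
- apply: le_trans (_ : normc w * normc (df s) <= _); last first.
    by rewrite ler_wpM2l ?normc_ge0 ?le_d.
  rewrite -normcM; apply: le_trans (ler_norm _) _.
  have -> : complex.Re w * complex.Re (df s) + complex.Im w * complex.Im (df s)
    = complex.Re (w^* * df s).
    by case: w {w_gt0 u} => a b; case: (df s) => c d /=; ring.
  apply: le_trans (normr_Re _) _; rewrite !normcM.
  by case: w {w_gt0 u} => a b /=; rewrite sqrrN.
Qed.

Lemma is_cderiveB s f g a b : is_cderive s f a -> is_cderive s g b ->
  is_cderive s (fun r => f r - g r) (a - b).
Proof.
move=> [fr fi] [gr gi]; split.
- rewrite (_ : (fun _ => _) = (fun r => complex.Re (f r)) -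
    (fun r => complex.Re (g r))); last first.
    by apply/funext => r; rewrite !fctE Re_addc Re_oppc.
  by rewrite Re_addc Re_oppc; apply: is_deriveB.
- rewrite (_ : (fun _ => _) = (fun r => complex.Im (f r)) -
    (fun r => complex.Im (g r))); last first.
    by apply/funext => r; rewrite !fctE Im_addc Im_oppc.
  by rewrite Im_addc Im_oppc; apply: is_deriveB.
Qed.

Lemma is_cderiveD s f g a b : is_cderive s f a -> is_cderive s g b ->
  is_cderive s (fun r => f r + g r) (a + b).
Proof.
move=> [fr fi] [gr gi]; split.
- rewrite (_ : (fun _ => _) = (fun r => complex.Re (f r)) +
    (fun r => complex.Re (g r))); last first.
    by apply/funext => r; rewrite !fctE Re_addc.
  by rewrite Re_addc; apply: is_deriveD.
- rewrite (_ : (fun _ => _) = (fun r => complex.Im (f r)) +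
    (fun r => complex.Im (g r))); last first.
    by apply/funext => r; rewrite !fctE Im_addc.
  by rewrite Im_addc; apply: is_deriveD.
Qed.

Lemma is_cderiveMr s f a z : is_cderive s f a ->
  is_cderive s (fun r => f r * z) (a * z).
Proof.
move=> [fr fi]; have frz := is_derive_scale (complex.Re z) fr.
have fiz := is_derive_scale (complex.Im z) fi.
have frz' := is_derive_scale (complex.Im z) fr.
have fiz' := is_derive_scale (complex.Re z) fi.
split.
- rewrite Re_mulc mulrC [X in _ - X]mulrC.
  rewrite (_ : (fun _ => _) = (fun r => complex.Re z * complex.Re (f r)) -
    (fun r => complex.Im z * complex.Im (f r))); first exact: is_deriveB.
  by apply/funext => r; rewrite !fctE Re_mulc mulrC [X in _ - X]mulrC.
- rewrite Im_mulc mulrC [X in _ + X]mulrC.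
  rewrite (_ : (fun _ => _) = (fun r => complex.Im z * complex.Re (f r)) +
    (fun r => complex.Re z * complex.Im (f r))); first exact: is_deriveD.
  by apply/funext => r; rewrite !fctE Im_mulc mulrC [X in _ + X]mulrC.
Qed.

Lemma is_cderiveXn s z k : is_cderive s (fun r => (r%:C) ^+ k * z)
  (k%:R * s%:C ^+ k.-1 * z).
Proof.
have E r c j : complex.Re (r%:C ^+ j * c) = r ^+ j * complex.Re c.
  by rewrite -rmorphXn Re_mulc /= mul0r subr0.
have E' r c j : complex.Im (r%:C ^+ j * c) = r ^+ j * complex.Im c.
  by rewrite -rmorphXn Im_mulc /= mul0r addr0.
have -> : k%:R * s%:C ^+ k.-1 * z = (s%:C) ^+ k.-1 * (k%:R * z) by ring.
have kR (c : C) : complex.Re (k%:R * c) = k%:R * complex.Re c.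
  by rewrite -[k%:R in LHS](rmorph_nat (real_complex R)) Re_mulc /= mul0r subr0.
have kI (c : C) : complex.Im (k%:R * c) = k%:R * complex.Im c.
  by rewrite -[k%:R in LHS](rmorph_nat (real_complex R)) Im_mulc /= mul0r addr0.
split.
- rewrite (_ : (fun _ => _) = (fun r => complex.Re z * r ^+ k)); last first.
    by apply/funext => r; rewrite E mulrC.
  by rewrite E kR (_ : _ * _ = complex.Re z * (k%:R * s ^+ k.-1));
    [apply: is_derive_scale; exact: is_derive_exprn|ring].
- rewrite (_ : (fun _ => _) = (fun r => complex.Im z * r ^+ k)); last first.
    by apply/funext => r; rewrite E' mulrC.
  by rewrite E' kI (_ : _ * _ = complex.Im z * (k%:R * s ^+ k.-1));
    [apply: is_derive_scale; exact: is_derive_exprn|ring].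
Qed.

Lemma is_cderive_cexp s z : is_cderive s (fun r => cexp (r%:C * z))
  (z * cexp (s%:C * z)).
Proof.
have scaled (f : R -> R) (c d : R) : is_derive (s * c) 1 f d ->
  is_derive s 1 (fun r => f (r * c)) (c * d).
  move=> fd; have id_d : is_derive s 1 (fun r => r * c) c.
    rewrite (_ : (fun _ => _) = (fun r => c * r)); last first.
      by apply/funext => r; rewrite mulrC.
    by rewrite -[X in is_derive _ _ _ X]mulr1; apply: is_derive_scale.
  by have := @is_derive1_comp _ f (fun r => r * c) s d c fd id_d; rewrite mulrC.
case: z => x y.
have ex := scaled _ _ _ (is_derive_expR (s * x)).
have cy := scaled _ _ _ (is_derive_cos (s * y)).
have sy := scaled _ _ _ (is_derive_sin (s * y)).
split.
- rewrite (_ : (fun _ => _) = (fun r => expR (r * x) * cos (r * y))); last first.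
    by apply/funext => r; rewrite /= !mul0r subr0 addr0.
  apply: is_derive_eq (is_derive_mul ex cy) _.
  rewrite /= !mul0r subr0 addr0; ring.
- rewrite (_ : (fun _ => _) = (fun r => expR (r * x) * sin (r * y))); last first.
    by apply/funext => r; rewrite /= !mul0r subr0 addr0.
  apply: is_derive_eq (is_derive_mul ex sy) _.
  rewrite /= !mul0r subr0 addr0; ring.
Qed.

End ComplexExponential.

(** * Remainders of the exponential series *)

Section ExponentialRemainders.
Variable R : realType.
Local Notation C := R[i].
Implicit Types (z w : C) (r s : R).

(** The index counts terms, so the remainder begins in degree [k]. The field is a parameter because
    the complex remainder is compared with the real one. *)
Definition exp_taylor (K : fieldType) (k : nat) (z : K) : K :=
  \sum_(j < k) z ^+ j / j`!%:R.

Lemma exp_taylorS (K : fieldType) k (z : K) :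
  exp_taylor k.+1 z = exp_taylor k z + z ^+ k / k`!%:R.
Proof. by rewrite /exp_taylor big_ord_recr. Qed.

Lemma exp_taylor_at0 (K : fieldType) k : exp_taylor k.+1 (0 : K) = 1.
Proof.
rewrite /exp_taylor big_ord_recl expr0 fact0 divr1 big1 ?addr0// => i _.
by rewrite expr0n mul0r.
Qed.

Lemma is_cderive_exp_taylor s z k :
  is_cderive s (fun r => exp_taylor k.+1 (r%:C * z))
    (z * exp_taylor k (s%:C * z)).
Proof.
elim: k => [|k IH].
  rewrite [exp_taylor 0 _]big_ord0 mulr0 (_ : (fun _ => _) = fun=> 1).
    by split; exact: is_derive_cst.
  by apply/funext => r; rewrite /exp_taylor big_ord1 expr0 fact0 divr1.
rewrite (_ : (fun _ => _) = fun r => exp_taylor k.+1 (r%:C * z) +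
    r%:C ^+ k.+1 * (z ^+ k.+1 / k.+1`!%:R)); last first.
  by apply/funext => r; rewrite exp_taylorS exprMn !mulrA.
rewrite exp_taylorS mulrDr.
have -> : z * ((s%:C * z) ^+ k / k`!%:R) =
    k.+1%:R * s%:C ^+ k.+1.-1 * (z ^+ k.+1 / k.+1`!%:R).
  rewrite factS natrM exprMn [z ^+ k.+1]exprS [k.+1.-1]/=.
  have : k.+1%:R != 0 :> C by rewrite pnatr_eq0.
  have : k`!%:R != 0 :> C by rewrite pnatr_eq0 -lt0n fact_gt0.
  move: k.+1%:R k`!%:R => a b b0 a0; field.
  by rewrite b0 a0.
exact: (is_cderiveD IH (is_cderiveXn _ _ _)).
Qed.

Definition exp_rem k r := expR r - exp_taylor k r.

Lemma Re_cexp_rem k r :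
  complex.Re (cexp r%:C - exp_taylor k r%:C) = exp_rem k r.
Proof.
rewrite Re_addc Re_oppc /= cos0 mulr1; congr (_ - _).
elim: k => [|k IH]; first by rewrite /exp_taylor !big_ord0.
rewrite !exp_taylorS Re_addc IH; congr (_ + _).
by rewrite -(rmorph_nat (real_complex R)) -fmorphV -rmorphXn -rmorphM.
Qed.

Lemma is_cderive_cexp_rem s z k :
  is_cderive s (fun r => cexp (r%:C * z) - exp_taylor k.+1 (r%:C * z))
    (z * (cexp (s%:C * z) - exp_taylor k (s%:C * z))).
Proof.
rewrite mulrBr; apply: is_cderiveB; first exact: is_cderive_cexp.
exact: is_cderive_exp_taylor.
Qed.

Lemma is_derive_exp_rem s r k :
  is_derive s 1 (fun t => exp_rem k.+1 (t * r)) (r * exp_rem k (s * r)).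
Proof.
have [] := is_cderive_cexp_rem s r%:C k.
rewrite (_ : (fun _ => _) = (fun t => exp_rem k.+1 (t * r))); last first.
  by apply/funext => t; rewrite -rmorphM Re_cexp_rem.
by move=> + _; rewrite Re_mulc /= mul0r subr0 -rmorphM Re_cexp_rem.
Qed.

Lemma exp_rem_at0 k : exp_rem k.+1 0 = 0.
Proof. by rewrite /exp_rem expR0 exp_taylor_at0 subrr. Qed.

(** Along the ray [r z] the remainder of order [k+1] has derivative [z] times the one of order [k],
    so the bound is integrated once per step, starting from [|e^z| = e^(Re z) <= e^|z|]. *)
Lemma normc_cexp_rem k z :
  normc (cexp z - exp_taylor k z) <= exp_rem k (normc z).
Proof.
elim: k z => [|k IH] z.
  rewrite /exp_rem /exp_taylor !big_ord0 !subr0 normc_cexp ler_expR.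
  exact: le_trans (ler_norm _) (normr_Re _).
have := @normc_mean_value R (fun r => cexp (r%:C * z) - exp_taylor k.+1 (r%:C * z))
  (fun s => z * (cexp (s%:C * z) - exp_taylor k (s%:C * z)))
  (fun t => exp_rem k.+1 (t * normc z))
  (fun s => normc z * exp_rem k (s * normc z)).
rewrite !mul1r !mul0r exp_rem_at0 cexp0 exp_taylor_at0 subrr !subr0; apply.
- by move=> s; exact: is_cderive_cexp_rem.
- by move=> s; exact: is_derive_exp_rem.
- move=> s /andP[s0 _]; rewrite normcM ler_wpM2l ?normc_ge0//.
  apply: (le_trans (IH _)); rewrite normcM normc_real ger0_norm//.
Qed.

Lemma exp_rem_step k (c r : R) : 0 <= r ->
  (forall s, 0 <= s <= r -> exp_rem k s <= c * s ^+ k) ->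
  exp_rem k.+1 r <= c / k.+1%:R * r ^+ k.+1.
Proof.
move=> r0 le_k.
have := @ler_mean_value R (fun t => exp_rem k.+1 (t * 1))
  (fun t => c / k.+1%:R * t ^+ k.+1) (fun s => 1 * exp_rem k (s * 1))
  (fun s => c / k.+1%:R * (k.+1%:R * s ^+ k)) r r0.
rewrite !mulr1 exp_rem_at0 expr0n /= mulr0 !subr0; apply.
- by move=> s; exact: is_derive_exp_rem.
- by move=> s; apply: is_derive_scale; exact: is_derive_exprn.
- move=> s s0r; rewrite mul1r mulr1 mulrA divfK ?pnatr_eq0//.
  exact: le_k.
Qed.

(** [(6 + 4 r + r^2) / (6 - 2 r)] is the [2/1] Pade approximant of the exponential. Two
    differentiations of the difference lead to [(1 - s) e^s <= 1], that is [1 - s <= e^(-s)]. *)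
Lemma expR_pade r : 0 <= r -> (6 - 2 * r) * expR r <= 6 + 4 * r + r ^+ 2.
Proof.
have h1 s : 0 <= 1 - (1 - s) * expR s.
  have := expR_ge1Dx (- s); rewrite expRN => le_e.
  have e0 := expR_gt0 s.
  have : (1 - s) * expR s <= 1 by rewrite -ler_pdivlMr// div1r.
  lra.
have h2 s : 0 <= s -> 0 <= 2 + s - (2 - s) * expR s.
  move=> s0.
  have D (t : R) : is_derive t 1 (fun t => 2 + t + (t - 2) * expR t)
      (1 - (1 - t) * expR t).
    have E : is_derive t 1 (fun t : R => t - 2) 1.
      by apply: is_derive_eq; rewrite subr0.
    have E' : is_derive t 1 (fun t : R => 2 + t) 1.
      by apply: is_derive_eq; rewrite add0r mulr1.
    apply: (is_derive_eq (is_deriveD E' (is_derive_mul E (is_derive_expR t)))).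
    ring.
  have := ler_mean_value s0 (is_derive_cst 0 ^~ 1) D.
  rewrite /cst subrr expR0 => /(_ (fun t _ => h1 t)).
  lra.
move=> r0.
have D (t : R) : is_derive t 1
    (fun t => (6 + t * (4 + t)) + (2 * t - 6) * expR t)
    (2 * (2 + t - (2 - t) * expR t)).
  have E : is_derive t 1 (fun t : R => 2 * t - 6) 2.
    by apply: is_derive_eq; rewrite subr0; exact: mulr1.
  have E' : is_derive t 1 (fun t : R => 4 + t) 1.
    by apply: is_derive_eq; rewrite add0r mulr1.
  have E6 : is_derive t 1 (fun t : R => 6 + t * (4 + t)) (t * 1 + (4 + t) * 1).
    have := is_derive_mul (is_derive_id t 1) E' => ?.
    by apply: is_derive_eq; rewrite add0r mul1r.
  apply: (is_derive_eq (is_deriveD E6 (is_derive_mul E (is_derive_expR t)))).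
  ring.
have := ler_mean_value r0 (is_derive_cst 0 ^~ 1) D.
rewrite /cst subrr expR0 => le_r.
have {le_r} := le_r (fun t t0r => mulr_ge0 (ler0n _ 2) (h2 t (andP t0r).1)).
lra.
Qed.

Lemma exp_rem2_pade r : 0 <= r < 3 -> exp_rem 2 r <= r * (3 * r / (2 * (3 - r))).
Proof.
move=> /andP[r0 r3]; have := expR_pade r0.
rewrite /exp_rem !exp_taylorS /exp_taylor big_ord0 add0r expr0 !divr1 expr1.
rewrite -ler_pdivlMl; last lra.
move=> /le_trans le_r; rewrite lerBlDl; apply: le_r.
rewrite -subr_ge0 (_ : _ - _ = 0)//; field; lra.
Qed.

(** This is [eta] of the overview. At 0 the convention on division returns 0, which is the limit. *)
Definition expdiv z := (cexp z - 1 - z) / z.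

Lemma expdivE z : z * expdiv z = cexp z - 1 - z.
Proof.
have [->|z0] := eqVneq z 0; first by rewrite mul0r cexp0 subrr subr0.
by rewrite mulrC divfK.
Qed.

(** The Pade bound of the remainder [e^r - 1 - r], divided by [r]; hence a bound for [|eta|] as
    well. *)
Definition pade_rate r := 3 * r / (2 * (3 - r)).

Lemma pade_rate_ge0 r : 0 <= r < 3 -> 0 <= pade_rate r.
Proof.
by move=> /andP[r0 r3]; apply: divr_ge0; rewrite mulr_ge0// subr_ge0 ltW.
Qed.

Lemma pade_rate_le r s : 0 <= r <= s -> s < 3 -> pade_rate r <= pade_rate s.
Proof.
move=> /andP[r0 rs] s3; rewrite /pade_rate ler_pdivrMr; last lra.
rewrite mulrAC ler_pdivlMr; last lra.
nra.
Qed.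

Lemma normc_cexp_rem2 z : normc z < 3 ->
  normc (cexp z - 1 - z) <= normc z * pade_rate (normc z).
Proof.
move=> z3; have := normc_cexp_rem 2 z.
rewrite !exp_taylorS {1}/exp_taylor big_ord0 add0r expr0 !divr1 expr1 opprD addrA.
by move=> /le_trans; apply; rewrite exp_rem2_pade// normc_ge0.
Qed.

Lemma normc_expdiv z : normc z < 3 -> normc (expdiv z) <= pade_rate (normc z).
Proof.
move=> z3; rewrite /expdiv normcM normcV.
have [->|z0] := eqVneq z 0.
  by rewrite normc0 invr0 mulr0 /pade_rate mulr0 mul0r.
have {}z0 : 0 < normc z.
  by rewrite lt_def normc_ge0 andbT; apply: contra z0 => /eqP/eq0_normc ->.
by rewrite ler_pdivrMr// mulrC normc_cexp_rem2.
Qed.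

(** On [[0, 9/10]] the factor [3 / (2 (3 - r))] is at most 5/7, and integration divides it by 3. The
    range is twice 9/20 because the bound is applied to [2 Re z]. *)
Lemma exp_rem3_le r : 0 <= r <= 9/10 -> exp_rem 3 r <= 5/21 * r ^+ 3.
Proof.
move=> /andP[r0 r1]; have -> : 5/21 = (5/7) / 3%:R :> R by lra.
apply: exp_rem_step => // s /andP[s0 sr].
apply: le_trans (exp_rem2_pade _) _; first by lra.
rewrite mulrA ler_pdivrMr; last lra.
nra.
Qed.

Lemma exp_rem4_le r : 0 <= r <= 1/2 -> exp_rem 4 r <= 1/20 * r ^+ 4.
Proof.
move=> /andP[r0 r1]; have -> : 1/20 = (1/5) / 4%:R :> R by lra.
apply: exp_rem_step => // s /andP[s0 sr].
have -> : 1/5 = (3/5) / 3%:R :> R by lra.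
apply: exp_rem_step => // t /andP[t0 ts].
apply: le_trans (exp_rem2_pade _) _; first by lra.
rewrite mulrA ler_pdivrMr; last lra.
nra.
Qed.

(* Both sides agree to first order in [z]; the coefficient 4 is what makes the
   squared metric distortion comparable with the gain in [refined_error]. *)
Lemma expR2_le z r : normc z <= r -> r <= 9/20 ->
  expR (2 * complex.Re z) <=
  1 + 4/3 * r ^+ 2 + 221/105 * r ^+ 3 + 4 * complex.Re (expdiv z).
Proof.
move=> zr r1; have z0 := normc_ge0 z.
set x := complex.Re z; set y := complex.Im z; set q := normc z; rewrite -/q in zr z0.
have xq : `|x| <= q := normr_Re z.
have q2 : x ^+ 2 + y ^+ 2 = q ^+ 2 by rewrite /q -cabs2E.
have H1 : expR (2 * x) <= 1 + 2 * x + 2 * x ^+ 2 + 40/21 * q ^+ 3.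
  have := normc_cexp_rem 3 (2 * x)%:C => /(le_trans (normr_Re _)).
  rewrite Re_cexp_rem normc_real normrM (ger0_norm (ler0n _ 2)) => le_rem.
  have {le_rem} := le_trans le_rem (exp_rem3_le _).
  rewrite mulr_ge0//=; move=> /(_ ltac:(lra)).
  rewrite /exp_rem !exp_taylorS /exp_taylor big_ord0 add0r.
  rewrite expr0 expr1 !divr1 => /(le_trans (ler_norm _)).
  have : `|x| ^+ 3 <= q ^+ 3 by rewrite lerXn2r ?nnegrE.
  rewrite !exprMn (_ : 2`!%:R = 2)// => ? ?; lra.
have H2 : x / 2 + (x ^+ 2 - y ^+ 2) / 6 - 1/20 * q ^+ 3 <=
    complex.Re (expdiv z).
  have [ze|z_neq0] := eqVneq z 0.
    rewrite /x /y /q ze normc0 /expdiv invr0 mulr0 /=; lra.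
  have q0 : 0 < q.
    by rewrite lt_def z0 andbT; apply: contra z_neq0 => /eqP/eq0_normc ->.
  have E : expdiv z - (z / 2 + z ^+ 2 / 6) = (cexp z - exp_taylor 4 z) / z.
    rewrite !exp_taylorS /exp_taylor big_ord0 /expdiv.
    rewrite (_ : 3`!%:R = 6)// (_ : 2`!%:R = 2)// (_ : 0`!%:R = 1)//.
    by rewrite ?(_ : 1`!%:R = 1)//; field.
  have : normc (expdiv z - (z / 2 + z ^+ 2 / 6)) <= 1/20 * q ^+ 3.
    rewrite E normcM normcV ler_pdivrMr// -[_ * q]mulrA -exprSr.
    by apply: le_trans (normc_cexp_rem 4 z) (exp_rem4_le _);
      rewrite -/q; lra.
  have -> : z / 2 + z ^+ 2 / 6 =
      (x / 2 + (x ^+ 2 - y ^+ 2) / 6) +i* (y / 2 + 2 * x * y / 6).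
    have R2 : 2^-1 = (2^-1)%:C :> C by rewrite fmorphV rmorph_nat.
    have R6 : 6^-1 = (6^-1)%:C :> C by rewrite fmorphV rmorph_nat.
    rewrite R2 R6 /x /y; case: (z) => a b; apply/eqP.
    by rewrite eq_complex /= !mulr0 !subr0 !add0r; apply/andP; split; apply/eqP; lra.
  move=> /(le_trans (normr_Re _)); rewrite Re_addc Re_oppc /=.
  by rewrite ler_norml => /andP[? _]; lra.
have : q ^+ 3 <= r ^+ 3 by rewrite lerXn2r ?nnegrE// (le_trans z0).
have : q ^+ 2 <= r ^+ 2 by rewrite lerXn2r ?nnegrE// (le_trans z0).
(* The linear terms [2 x] cancel. What is left is [4/3 x^2 + 2/3 y^2 <= 4/3 q^2], and
   [40/21 + 4/20 = 221/105] in degree 3. *)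
have := sqr_ge0 y; lra.
Qed.

End ExponentialRemainders.

(** * Weighted l2 norms of families of coefficients *)

Section WeightedNorm.
Variables (R : realType) (J : finType) (p : J -> R).
Hypothesis p_ge0 : forall j, 0 <= p j.
Local Notation C := R[i].
Implicit Types (y w : J -> C).

Lemma sum_CauchySchwarz (I : finType) (a b : I -> R) :
  (\sum_i a i * b i) ^+ 2 <= (\sum_i a i ^+ 2) * (\sum_i b i ^+ 2).
Proof.
set c := \sum_i a i * b i; set sa := \sum_i a i ^+ 2; set sb := \sum_i b i ^+ 2.
have sb0 : 0 <= sb by apply: sumr_ge0 => i _; exact: sqr_ge0.
have [sbE|sb_neq0] := eqVneq sb 0.
  suff -> : c = 0 by rewrite sbE mulr0 expr0n.
  rewrite /c big1// => i _.
  have b_ge0 k : true -> 0 <= b k ^+ 2 by rewrite sqr_ge0.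
  have /eqP := psumr_eq0P b_ge0 sbE (i := i) isT.
  by rewrite sqrf_eq0 => /eqP ->; rewrite mulr0.
have {sb_neq0}sb_gt0 : 0 < sb by rewrite lt_def sb_neq0.
have : 0 <= \sum_i (sb * a i - c * b i) ^+ 2.
  by apply: sumr_ge0 => i _; exact: sqr_ge0.
have -> : \sum_i (sb * a i - c * b i) ^+ 2 = sb * (sa * sb - c ^+ 2).
  rewrite (eq_bigr (fun i => sb ^+ 2 * a i ^+ 2 - (2 * sb * c) * (a i * b i) +
      c ^+ 2 * b i ^+ 2)); last by move=> i _; ring.
  by rewrite !big_split /= sumrN -!mulr_sumr -/sa -/sb -/c; ring.
by rewrite pmulr_rge0// subr_ge0.
Qed.

Definition wnorm y := Num.sqrt (\sum_j p j * cabs2 (y j)).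

Lemma cabs2_ge0 (z : C) : 0 <= cabs2 z.
Proof. by rewrite cabs2E sqr_ge0. Qed.

Lemma wnorm_ge0 y : 0 <= wnorm y.
Proof. exact: sqrtr_ge0. Qed.

Lemma wnorm2 y : wnorm y ^+ 2 = \sum_j p j * cabs2 (y j).
Proof.
by rewrite sqr_sqrtr// sumr_ge0// => j _; rewrite mulr_ge0// cabs2_ge0.
Qed.

Lemma eq_wnorm y w : y =1 w -> wnorm y = wnorm w.
Proof. by move=> yw; congr Num.sqrt; apply: eq_bigr => j _; rewrite yw. Qed.

Lemma wnorm_dominated (K : R) y w : 0 <= K ->
  (forall j, normc (y j) <= K * normc (w j)) -> wnorm y <= K * wnorm w.
Proof.
move=> K0 yw; rewrite -[K]ger0_norm// -sqrtr_sqr -sqrtrM ?sqr_ge0//.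
apply: ler_wsqrtr; rewrite mulr_sumr; apply: ler_sum => j _.
rewrite mulrCA ler_wpM2l// !cabs2E -exprMn lerXn2r ?nnegrE ?mulr_ge0 ?normc_ge0//.
Qed.

Lemma wnorm_isometric y w : (forall j, normc (y j) = normc (w j)) ->
  wnorm y = wnorm w.
Proof. by move=> yw; congr Num.sqrt; apply: eq_bigr => j _; rewrite !cabs2E yw. Qed.

Lemma wnormZ (c : C) y : wnorm (fun j => c * y j) = normc c * wnorm y.
Proof.
rewrite -[normc c]ger0_norm ?normc_ge0// -sqrtr_sqr -sqrtrM ?sqr_ge0//.
congr Num.sqrt; rewrite mulr_sumr; apply: eq_bigr => j _.
by rewrite !cabs2E normcM exprMn mulrCA.
Qed.

Lemma wnormN y : wnorm (fun j => - y j) = wnorm y.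
Proof. by apply: wnorm_isometric => j; rewrite normcN. Qed.

Lemma wnormD y w : wnorm (fun j => y j + w j) <= wnorm y + wnorm w.
Proof.
rewrite -(@ler_pXn2r _ 2) ?nnegrE ?addr_ge0 ?wnorm_ge0// wnorm2 sqrrD !wnorm2.
have CS : \sum_j p j * (normc (y j) * normc (w j)) <= wnorm y * wnorm w.
  rewrite -(@ler_pXn2r _ 2) ?nnegrE ?mulr_ge0 ?wnorm_ge0//; last first.
    by apply: sumr_ge0 => j _; rewrite !mulr_ge0 ?normc_ge0.
  rewrite exprMn !wnorm2.
  have := @sum_CauchySchwarz J (fun j => Num.sqrt (p j) * normc (y j))
    (fun j => Num.sqrt (p j) * normc (w j)).
  under eq_bigr do rewrite mulrACA -expr2 sqr_sqrtr//.
  under [X in _ <= X * _]eq_bigr do rewrite exprMn sqr_sqrtr// -cabs2E.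
  by under [X in _ <= _ * X]eq_bigr do rewrite exprMn sqr_sqrtr// -cabs2E.
apply: le_trans (_ : _ <= \sum_j p j * cabs2 (y j) +
    (\sum_j p j * (normc (y j) * normc (w j))) *+ 2 + \sum_j p j * cabs2 (w j)) _.
  rewrite -sumrMnl -!big_split /=; apply: ler_sum => j _.
  rewrite -mulrnAr -!mulrDr ler_wpM2l// !cabs2E -sqrrD.
  by rewrite lerXn2r ?nnegrE ?addr_ge0 ?normc_ge0// le_normcD.
by rewrite lerD2r lerD2l lerMn2r.
Qed.

(* [2 e y - h y] is the reflection of [h y] across the real line of [y]. *)
Lemma wnorm_reflection (h y : J -> C) (e : R) :
  \sum_j p j * (complex.Re (h j) * cabs2 (y j)) = e * wnorm y ^+ 2 ->
  wnorm (fun j => ((2 * e)%:C - h j) * y j) = wnorm (fun j => h j * y j).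
Proof.
move=> eE; congr Num.sqrt.
transitivity (\sum_j (4 * e ^+ 2 * (p j * cabs2 (y j)) -
    4 * e * (p j * (complex.Re (h j) * cabs2 (y j))) + p j * cabs2 (h j * y j))).
  apply: eq_bigr => j _; rewrite /cabs2.
  by case: (h j) => a b; case: (y j) => c d /=; ring.
rewrite !big_split /= sumrN -!mulr_sumr eE wnorm2; ring.
Qed.

End WeightedNorm.

(** * Limits of geometrically Cauchy sequences *)

Section GeometricSequences.
Variable R : realType.
Implicit Types (a : nat -> R) (K q x : R).

Lemma le0_geometric x K q : 0 <= q < 1 -> (forall k, x <= K * q ^+ k) -> x <= 0.
Proof.
move=> /andP[q0 q1] xK.
have q_cvg : K * q ^+ k @[k --> \oo] --> K * 0.
  by apply: cvgMl_tmp; apply: cvg_expr; rewrite ger0_norm.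
by rewrite -(mulr0 K); apply: (cvgr_to_ge q_cvg); apply: nearW.
Qed.

(** [M = K / (1 - q)] makes the intervals of centre [a k] and radius [M q^k] nested; the supremum of
    their left ends lies in all of them. *)
Lemma geometric_limit a K q : 0 <= q < 1 ->
  (forall k, `|a k.+1 - a k| <= K * q ^+ k) ->
  exists L, forall k, `|a k - L| <= K / (1 - q) * q ^+ k.
Proof.
move=> /andP[q0 q1] aK; set M := K / (1 - q).
have MK : M * (1 - q) = K by rewrite divfK// subr_eq0 gt_eqF.
have K0 : 0 <= K by have := aK 0; rewrite expr0 mulr1; exact: le_trans.
have M0 : 0 <= M by rewrite divr_ge0// subr_ge0 ltW.
pose lo k := a k - M * q ^+ k; pose up k := a k + M * q ^+ k.
have step k : M * q ^+ k = K * q ^+ k + M * q ^+ k.+1.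
  by rewrite -[in K * _]MK exprS; ring.
have lo_nd : {homo lo : i j / (i <= j)%N >-> i <= j}.
  apply: homo_leq => // [x y z|k]; first exact: le_trans.
  rewrite /lo step; have := aK k; rewrite ler_norml => /andP[]; lra.
have up_ni : {homo up : i j / (i <= j)%N >-> j <= i}.
  apply: homo_leq => // [x y z|k]; first by move=> /[swap]; exact: le_trans.
  rewrite /up [in X in _ <= X]step; have := aK k; rewrite ler_norml => /andP[]; lra.
have lo_up i j : lo i <= up j.
  apply: (le_trans (lo_nd _ _ (leq_maxl i j))).
  apply: le_trans (up_ni _ _ (leq_maxr i j)).
  rewrite lerD2l; apply: (@le_trans _ _ 0); rewrite ?oppr_le0;
    exact: mulr_ge0 (exprn_ge0 _ _).
exists (sup (range lo)) => k.
have loL : lo k <= sup (range lo).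
  apply: ub_le_sup; last by exists k.
  by exists (up 0) => _ [i _ <-].
have upL : sup (range lo) <= up k.
  by apply: ge_sup => [|_ [i _ <-]//]; exists (lo 0); exists 0.
rewrite ler_norml; move: loL upL; rewrite /lo /up; lra.
Qed.

End GeometricSequences.

(** For [e <= 0] one drops [4 e] and uses the first bound on [x]. For [e > 0],
    [A + 4 e <= A (1 + 2 e)^2] because [A >= 1], and the second bound gives
    [(1 + 2 e) x <= k b / (1 - k)]: the larger metric is offset by the smaller error. *)
Lemma distorted_square_le (R : realType) (A e k b x : R) : 1 <= A -> 0 <= x ->
  0 <= b -> 0 <= k -> k < 1 -> x <= k * (b + x) ->
  (1 + 2 * e) * x <= k * (b + x) ->
  (A + 4 * e) * x ^+ 2 <= A * (k * b / (1 - k)) ^+ 2.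
Proof.
move=> A1 x0 b0 k0 k1 xb exb; set X := k * b / (1 - k).
have k10 : 0 < 1 - k by rewrite subr_gt0.
have XE : X * (1 - k) = k * b by rewrite divfK// gt_eqF.
have X0 : 0 <= X by apply: divr_ge0; [exact: mulr_ge0|exact: ltW].
have xX : x <= X by rewrite -(ler_pM2r k10) XE; lra.
have A0 : 0 <= A by lra.
have [e0|e0] := lerP e 0.
  apply: (@le_trans _ _ (A * x ^+ 2)).
    by apply: ler_wpM2r; [exact: sqr_ge0|lra].
  by rewrite ler_wpM2l// lerXn2r ?nnegrE.
have exX : (1 + 2 * e) * x <= X by rewrite -(ler_pM2r k10) XE; nra.
apply: (@le_trans _ _ (A * ((1 + 2 * e) * x) ^+ 2)).
  have -> : A * ((1 + 2 * e) * x) ^+ 2 = A * (1 + 2 * e) ^+ 2 * x ^+ 2 by ring.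
  by apply: ler_wpM2r; [exact: sqr_ge0|nra].
by rewrite ler_wpM2l// lerXn2r ?nnegrE// mulr_ge0//; lra.
Qed.

(** * Newton's method for a preconditioned exponential system *)

Section ExponentialNewton.
Variables (R : realType) (n : nat) (J : finType) (p : J -> R).
Hypothesis p_ge0 : forall j, 0 <= p j.
Local Notation C := R[i].
Local Notation Cn := 'cV[C]_n.
Variables (l : J -> 'rV[C]_n) (c : J -> Cn) (mu nu : R).

(** In the notation of the overview, [linform] is [z], [expform] is [e^z] and [synthesis] is
    [Phi]. *)
Definition linform (w : Cn) (j : J) : C := (l j *m w) 0 0.
Definition expform (w : Cn) (j : J) : C := cexp (linform w j).
Definition synthesis (y : J -> C) : Cn := \sum_j y j *: c j.
Local Notation hn := (wnorm p).
Local Notation N w := (wnorm p (linform w)).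

Hypothesis synthK : forall w, synthesis (linform w) = w.
Hypothesis synth_bound : forall y, N (synthesis y) <= mu * hn y.
Hypothesis lin_bound : forall w j, normc (linform w j) <= nu * N w.
Hypothesis mu_ge0 : 0 <= mu.
Hypothesis nu_ge0 : 0 <= nu.

Local Notation b := (- synthesis (fun=> 1)).

Lemma linformD u w j : linform (u + w) j = linform u j + linform w j.
Proof. by rewrite /linform mulmxDr mxE. Qed.

Lemma linformN u j : linform (- u) j = - linform u j.
Proof. by rewrite /linform mulmxN mxE. Qed.

Lemma linformB u w j : linform (u - w) j = linform u j - linform w j.
Proof. by rewrite linformD linformN. Qed.

Lemma linformZ (a : C) u j : linform (a *: u) j = a * linform u j.
Proof. by rewrite /linform -scalemxAr mxE. Qed.

Lemma synthesisD y w : synthesis (fun j => y j + w j) = synthesis y + synthesis w.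
Proof. by rewrite /synthesis -big_split /=; apply: eq_bigr => j _; rewrite scalerDl. Qed.

Lemma synthesisN y : synthesis (fun j => - y j) = - synthesis y.
Proof. by rewrite /synthesis -sumrN; apply: eq_bigr => j _; rewrite scaleNr. Qed.

Lemma synthesisB y w : synthesis (fun j => y j - w j) = synthesis y - synthesis w.
Proof. by rewrite synthesisD synthesisN. Qed.

Lemma synthesisZ (a : C) y : synthesis (fun j => a * y j) = a *: synthesis y.
Proof. by rewrite /synthesis scaler_sumr; apply: eq_bigr => j _; rewrite scalerA. Qed.

Lemma eq_synthesis y w : y =1 w -> synthesis y = synthesis w.
Proof. by move=> yw; apply: eq_bigr => j _; rewrite yw. Qed.

Lemma wnorm_linform_ge0 u : 0 <= N u. Proof. exact: wnorm_ge0. Qed.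

Lemma wnorm_linformD u w : N (u + w) <= N u + N w.
Proof. by rewrite (eq_wnorm p (linformD u w)) wnormD. Qed.

Lemma wnorm_linformN u : N (- u) = N u.
Proof. by rewrite (eq_wnorm p (linformN u)) wnormN. Qed.

Lemma wnorm_linformB u w : N (u - w) <= N u + N w.
Proof. by rewrite -(wnorm_linformN w) wnorm_linformD. Qed.

Lemma wnorm_linform_sub u w : N (u - w) = N (w - u).
Proof. by rewrite -wnorm_linformN opprB. Qed.

(** Here the seminorm is seen to be a norm: [lin_bound] kills every [linform u j], and [synthK]
    recovers [u] from them. *)
Lemma wnorm_linform_eq0 u : N u = 0 -> u = 0.
Proof.
move=> u0; rewrite -(synthK u) /synthesis big1// => j _.
have := lin_bound u j; rewrite u0 mulr0 => le0.
have : normc (linform u j) = 0 by apply/eqP; rewrite eq_le le0 normc_ge0.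
by move=> /eq0_normc ->; rewrite scale0r.
Qed.

Lemma wnorm_linform0 : N (0 : Cn) = 0.
Proof.
have := wnormZ p 0 (linform 0); rewrite normc0 mul0r => <-.
by apply: eq_wnorm => j; rewrite mul0r /linform mulmx0 mxE.
Qed.

Lemma linform0 j : linform 0 j = 0.
Proof. by rewrite /linform mulmx0 mxE. Qed.

Lemma synthesisE y i : synthesis y i 0 = \sum_j y j * c j i 0.
Proof. by rewrite /synthesis summxE; apply: eq_bigr => j _; rewrite mxE. Qed.

Local Opaque wnorm linform synthesis.

Lemma linform_le u t j : nu * N u <= t -> normc (linform u j) <= t.
Proof. exact: le_trans. Qed.

Lemma wnorm_rem u t : nu * N u <= t -> t < 3 ->
  hn (fun j => expform u j - 1 - linform u j) <= pade_rate t * N u.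
Proof.
move=> ut t3; have t0 : 0 <= t by apply: le_trans ut; rewrite mulr_ge0 ?wnorm_linform_ge0.
have k0 : 0 <= pade_rate t by rewrite pade_rate_ge0// t0.
apply: wnorm_dominated => // j; have jt := linform_le j ut.
apply: (le_trans (normc_cexp_rem2 (le_lt_trans jt t3))).
by rewrite mulrC ler_wpM2r ?normc_ge0// pade_rate_le// normc_ge0.
Qed.

Lemma wnorm_expf_sub1_mul u w t : nu * N u <= t ->
  hn (fun j => (expform u j - 1) * linform w j) <= (expR t - 1) * N w.
Proof.
move=> ut; have t0 : 0 <= t by apply: le_trans ut; rewrite mulr_ge0 ?wnorm_linform_ge0.
have e0 : 0 <= expR t - 1 by rewrite subr_ge0 -expR0 ler_expR.
apply: wnorm_dominated => // j.
rewrite normcM ler_wpM2r ?normc_ge0//.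
have := normc_cexp_rem 1 (linform u j).
rewrite /exp_rem /exp_taylor !big_ord1 !expr0 !divr1 => /le_trans; apply.
by rewrite lerB// ler_expR linform_le.
Qed.

(** On the segment from [w] to [z] the derivative is [(z - w) (e^v - 1)] with [|v| <= t] by
    convexity. *)
Lemma normc_cexp_diff (z w : C) t : normc z <= t -> normc w <= t ->
  normc (cexp z - cexp w - (z - w)) <= normc (z - w) * (expR t - 1).
Proof.
move=> zt wt; set d := z - w.
have D s : is_cderive s (fun r => cexp w * cexp (r%:C * d) - r%:C * d)
    (cexp w * (d * cexp (s%:C * d)) - d).
  apply: is_cderiveB.
    rewrite (_ : (fun _ => _) = fun r => cexp (r%:C * d) * cexp w).
      by rewrite mulrC; exact: is_cderiveMr (is_cderive_cexp _ _).
    by apply/funext => r; rewrite mulrC.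
  by have := is_cderiveXn s d 1; rewrite /= expr0 !mul1r.
have := @normc_mean_value R _ _ (fun s => normc d * (expR t - 1) * s)
  (fun=> normc d * (expR t - 1)) D.
rewrite !mul1r !mul0r cexp0 !mulr1 -cexpD subr0 !mulr0 !subr0.
rewrite (_ : w + d = z); last by rewrite addrC subrK.
rewrite (_ : cexp z - d - cexp w = cexp z - cexp w - d); last by ring.
apply.
- move=> s; rewrite -[X in is_derive _ _ _ X]mulr1.
  by apply: is_derive_scale; exact: is_derive_id.
- move=> s /andP[s0 s1].
  rewrite mulrCA -cexpD -[X in _ - X]mulr1 -mulrBr normcM ler_wpM2l ?normc_ge0//.
  have := normc_cexp_rem 1 (w + s%:C * d).
  rewrite /exp_rem /exp_taylor !big_ord1 !expr0 !divr1 => /le_trans; apply.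
  rewrite lerB// ler_expR.
  have -> : w + s%:C * d = (1 - s)%:C * w + s%:C * z.
    by rewrite /d rmorphB rmorph1; ring.
  apply: (le_trans (le_normcD _ _)); rewrite !normcM !normc_real.
  rewrite !ger0_norm ?subr_ge0//; nra.
Qed.

Lemma wnorm_expf_diff u w t : nu * N u <= t -> nu * N w <= t ->
  hn (fun j => expform u j - expform w j - linform (u - w) j) <= (expR t - 1) * N (u - w).
Proof.
move=> ut wt; have t0 : 0 <= t by apply: le_trans ut; rewrite mulr_ge0 ?wnorm_linform_ge0.
have e0 : 0 <= expR t - 1 by rewrite subr_ge0 -expR0 ler_expR.
apply: wnorm_dominated => // j.
by rewrite linformB mulrC; apply: normc_cexp_diff; rewrite linform_le.
Qed.

(** The derivative of the preconditioned system at 0 is the identity by [synthK], so the linear part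
    of [u] cancels and only a remainder of second order is left. *)
Lemma simplified_newtonE u :
  u - synthesis (expform u) = b - synthesis (fun j => expform u j - 1 - linform u j).
Proof. by rewrite !synthesisB synthK !opprB addrCA addKr. Qed.

Lemma simplified_newton_bound u t : nu * N u <= t -> t < 3 ->
  N (u - synthesis (expform u)) <= N b + mu * (pade_rate t * N u).
Proof.
move=> ut t3; rewrite simplified_newtonE; apply: (le_trans (wnorm_linformB _ _)).
rewrite lerD2l; apply: (le_trans (synth_bound _)).
by rewrite ler_wpM2l// wnorm_rem.
Qed.

Lemma simplified_newton_contracts u w t : nu * N u <= t -> nu * N w <= t ->
  N (u - synthesis (expform u) - (w - synthesis (expform w))) <=
  mu * (expR t - 1) * N (u - w).
Proof.
move=> ut wt.
have -> : u - synthesis (expform u) - (w - synthesis (expform w)) =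
    - synthesis (fun j => expform u j - expform w j - linform (u - w) j).
  rewrite !synthesisB synthK !opprB addrACA [RHS]addrACA.
  by congr (_ + _); rewrite addrC.
rewrite wnorm_linformN; apply: (le_trans (synth_bound _)).
by rewrite -mulrA ler_wpM2l// wnorm_expf_diff.
Qed.

Lemma wnorm_linform_le_coord u : N u <= \sum_i normc (u i 0) * N (delta_mx i 0).
Proof.
have {1}-> : u = \sum_i u i 0 *: delta_mx i 0.
  rewrite [LHS]matrix_sum_delta; apply: eq_bigr => i _.
  by rewrite big_ord1.
elim/big_ind2 : _ => [|u1 x1 u2 x2 le1 le2|i _]; first by rewrite wnorm_linform0.
  by apply: (le_trans (wnorm_linformD _ _)); exact: lerD.
by rewrite (eq_wnorm p (linformZ _ _)) wnormZ.
Qed.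

(** With [wnorm_linform_le_coord] this makes the norm equivalent to the size of the coordinates, so
    limits can be taken coordinate by coordinate. *)
Lemma coord_le_wnorm_linform (u : Cn) i :
  normc (u i 0) <= \sum_j (normc (c j i 0) * nu * N u).
Proof.
rewrite -[in X in X <= _](synthK u) synthesisE; apply: (le_trans (normc_sum _)).
apply: ler_sum => j _; rewrite normcM mulrC -mulrA.
by rewrite ler_wpM2l ?normc_ge0.
Qed.

(** Stability of the ball and contraction are two separate conditions: the first, by the remainder
    bound, fixes the radius sharply; of the second only [q < 1] matters. *)
Lemma exists_root h q : 0 <= h -> nu * h < 3 ->
  N b + mu * (pade_rate (nu * h) * h) <= h ->
  mu * (expR (nu * h) - 1) <= q -> q < 1 ->
  exists2 u, synthesis (expform u) = 0 & N u <= h.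
Proof.
move=> h0 nuh3 bh muq q1.
have q0 : 0 <= q.
  apply: le_trans muq; rewrite mulr_ge0// subr_ge0 -expR0 ler_expR.
  exact: mulr_ge0.
have nuh u : N u <= h -> nu * N u <= nu * h by exact: ler_wpM2l.
pose T u := u - synthesis (expform u).
have Th u : N u <= h -> N (T u) <= h.
  move=> uh; apply: le_trans bh.
  apply: (le_trans (simplified_newton_bound (nuh _ uh) nuh3)).
  rewrite lerD2l !ler_wpM2l//.
  by rewrite pade_rate_ge0// mulr_ge0.
have Tq u w : N u <= h -> N w <= h -> N (T u - T w) <= q * N (u - w).
  move=> uh wh.
  apply: (le_trans (simplified_newton_contracts (nuh _ uh) (nuh _ wh))).
  by rewrite ler_wpM2r// wnorm_linform_ge0.
have [v v0 vE] : exists2 v : nat -> Cn, v 0%N = 0 & forall k, v k.+1 = T (v k).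
  by exists (fun k => iter k T 0).
have vh k : N (v k) <= h by elim: k => [|k IH]; [rewrite v0 wnorm_linform0|rewrite vE; exact: Th].
have vS k : N (v k.+1 - v k) <= N (T 0) * q ^+ k.
  elim: k => [|k IH]; first by rewrite expr0 mulr1 vE v0 subr0.
  rewrite exprS mulrCA (vE k.+1) [X in _ - X](vE k).
  by apply: (le_trans (Tq _ _ (vh k.+1) (vh k))); rewrite ler_wpM2l.
have coord i : exists L : C, exists K, forall k, normc (v k i 0 - L) <= K * q ^+ k.
  set M := \sum_j (normc (c j i 0) * nu).
  have M0 : 0 <= M by apply: sumr_ge0 => j _; rewrite mulr_ge0 ?normc_ge0.
  have vi k : normc (v k.+1 i 0 - v k i 0) <= M * N (T 0) * q ^+ k.
    have := coord_le_wnorm_linform (v k.+1 - v k) i; rewrite !mxE => /le_trans; apply.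
    by rewrite -mulr_suml -mulrA ler_wpM2l.
  have q01 : 0 <= q < 1 by rewrite q0.
  have [|x xP] := @geometric_limit R (fun k => complex.Re (v k i 0)) (M * N (T 0)) q q01.
    by move=> k; rewrite -Re_oppc -Re_addc (le_trans (normr_Re _)).
  have [|y yP] := @geometric_limit R (fun k => complex.Im (v k i 0)) (M * N (T 0)) q q01.
    by move=> k; rewrite -Im_oppc -Im_addc (le_trans (normr_Im _)).
  exists (x +i* y); eexists => k.
  apply: (@le_trans _ _ (`|complex.Re (v k i 0) - x| + `|complex.Im (v k i 0) - y|)).
    have -> : v k i 0 - x +i* y = (complex.Re (v k i 0) - x)%:C +
        'i%C * (complex.Im (v k i 0) - y)%:C.
      by case: (v k i 0) => a d; simpc.
    apply: (le_trans (le_normcD _ _)); rewrite normcM !normc_real.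
    by rewrite [normc 'i%C]/= expr0n expr1n add0r sqrtr1 mul1r.
  by apply: (le_trans (lerD (xP k) (yP k))); rewrite -mulrDl.
have [L LP] := @choice _ _ (fun i (L : C) => exists K, forall k,
  normc (v k i 0 - L) <= K * q ^+ k) coord.
have [K KP] := @choice _ _ (fun i K => forall k,
  normc (v k i 0 - L i) <= K * q ^+ k) LP.
pose u : Cn := \col_i L i.
pose M := \sum_i K i * N (delta_mx i 0).
have uM k : N (v k - u) <= M * q ^+ k.
  apply: (le_trans (wnorm_linform_le_coord _)); rewrite mulr_suml; apply: ler_sum => i _.
  by rewrite mulrAC ler_wpM2r ?wnorm_linform_ge0// !mxE.
have q01 : 0 <= q < 1 by rewrite q0.
have uh : N u <= h.
  rewrite -subr_le0; apply: (le0_geometric (K := M) q01) => k.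
  rewrite lerBlDr; have -> : u = (u - v k) + v k by rewrite subrK.
  by apply: (le_trans (wnorm_linformD _ _)); apply: lerD => //; rewrite wnorm_linform_sub.
exists u => //; apply: wnorm_linform_eq0; apply/eqP; rewrite eq_le wnorm_linform_ge0 andbT.
(* [synthesis (expform u)] is [u - T u], and both [v k.+1 - T u] and [v k.+1 - u] tend to 0
   geometrically. *)
apply: (le0_geometric (K := (q * M + M * q)) q01) => k.
have -> : synthesis (expform u) = (v k.+1 - T u) - (v k.+1 - u).
  by rewrite /T !opprB [RHS]addrC [RHS]addrA subrK [RHS]addrC subrK.
apply: (le_trans (wnorm_linformB _ _)); rewrite mulrDl; apply: lerD.
  by rewrite vE; apply: (le_trans (Tq _ _ (vh k) uh)); rewrite -mulrA ler_wpM2l.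
by rewrite -mulrA -exprS.
Qed.

(** The derivative at [y] is the identity plus a perturbation of norm at most [mu (e^t - 1)], while
    the Taylor remainder at [y] is [e^z(y)] times the remainder at 0 evaluated at [u - y],
    exponentials being multiplicative. The step [y'] enters through the linear equation that defines
    it. *)
Lemma newton_error y y' u t : nu * N y <= t -> synthesis (expform u) = 0 ->
  nu * N (y - u) < 3 ->
  synthesis (fun j => expform y j * linform (y' - y) j) = - synthesis (expform y) ->
  (1 - mu * (expR t - 1)) * N (y' - u) <=
  mu * (expR t * (pade_rate (nu * N (y - u)) * N (y - u))).
Proof.
move=> yt u0 yu3 yE; set w := y' - u.
have E : w + synthesis (fun j => (expform y j - 1) * linform w j) =
    synthesis (fun j => expform y j * (expform (u - y) j - 1 - linform (u - y) j)).
  rewrite -{1}(synthK w) -synthesisD.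
  transitivity (synthesis (fun j => expform y j * linform (y' - y) j) +
      (synthesis (expform u) + synthesis (fun j => expform y j * linform (y - u) j))).
    rewrite u0 add0r -synthesisD; apply: eq_synthesis => j.
    by rewrite /w !linformB; ring.
  rewrite yE -synthesisN -!synthesisD; apply: eq_synthesis => j.
  have -> : expform u j = expform y j * expform (u - y) j.
    by rewrite /expform -cexpD -linformD addrC subrK.
  by rewrite !linformB; ring.
have le1 : N w - mu * ((expR t - 1) * N w) <=
    N (w + synthesis (fun j => (expform y j - 1) * linform w j)).
  rewrite lerBlDr; apply: (@le_trans _ _ (N (w + synthesis (fun j => (expform y j - 1) * linform w j)) +
      N (synthesis (fun j => (expform y j - 1) * linform w j)))).
    by rewrite -{1}(addrK (synthesis (fun j => (expform y j - 1) * linform w j)) w) wnorm_linformB.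
  rewrite lerD2l; apply: (le_trans (synth_bound _)).
  by rewrite ler_wpM2l// wnorm_expf_sub1_mul.
rewrite mulrBl mul1r -mulrA; apply: (le_trans le1); rewrite E.
apply: (le_trans (synth_bound _)); rewrite ler_wpM2l//.
apply: (@le_trans _ _ (expR t * hn (fun j => expform (u - y) j - 1 - linform (u - y) j))).
  apply: wnorm_dominated => // j; rewrite normcM ler_wpM2r ?normc_ge0// normc_cexp ler_expR.
  exact: le_trans (ler_norm _) (le_trans (normr_Re _) (linform_le _ yt)).
rewrite (wnorm_linform_sub y u) in yu3 *; apply: ler_wpM2l; first exact: expR_ge0.
exact: wnorm_rem.
Qed.

Lemma newton_derivative_inj y w t : nu * N y <= t -> mu * (expR t - 1) < 1 ->
  synthesis (fun j => expform y j * linform w j) = 0 -> w = 0.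
Proof.
move=> yt mut w0; apply: wnorm_linform_eq0; apply/eqP; rewrite eq_le wnorm_linform_ge0 andbT.
have wE : w = - synthesis (fun j => (expform y j - 1) * linform w j).
  rewrite -synthesisN.
  transitivity (synthesis (linform w) - synthesis (fun j => expform y j * linform w j)).
    by rewrite w0 subr0 synthK.
  by rewrite -synthesisB; apply: eq_synthesis => j; ring.
have : N w <= mu * ((expR t - 1) * N w).
  rewrite {1}wE wnorm_linformN; apply: (le_trans (synth_bound _)).
  by rewrite ler_wpM2l// wnorm_expf_sub1_mul.
have := wnorm_linform_ge0 w; nra.
Qed.

(* [b] is the first Newton iterate. The claim [main] is used with the [e] that
   makes [2 e V - h V] the reflection of [h V] in [V], and with [e = 0]. *)
Lemma refined_error u t (A : R) : synthesis (expform u) = 0 -> nu * N u <= t -> t < 3 ->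
  1 <= A -> mu * pade_rate t < 1 ->
  (forall j, expR (2 * complex.Re (linform u j)) <=
    A + 4 * complex.Re (expdiv (linform u j))) ->
  \sum_j p j * (expR (2 * complex.Re (linform u j)) * cabs2 (linform (b - u) j)) <=
  A * (mu * pade_rate t * N b / (1 - mu * pade_rate t)) ^+ 2.
Proof.
move=> u0 ut t3 A1 mut Ale; set v := b - u; set kap := pade_rate t.
have t0 : 0 <= t by apply: le_trans ut; rewrite mulr_ge0 ?wnorm_linform_ge0.
have kap0 : 0 <= kap by rewrite pade_rate_ge0// t0.
pose h j := expdiv (linform u j).
have hk j : normc (h j) <= kap.
  have jt := linform_le j ut; apply: (le_trans (normc_expdiv (le_lt_trans jt t3))).
  by apply: pade_rate_le => //; rewrite normc_ge0.
have hw w : hn (fun j => h j * linform w j) <= kap * N w.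
  by apply: wnorm_dominated => // j; rewrite normcM ler_wpM2r ?normc_ge0.
have E : v + synthesis (fun j => h j * linform v j) = synthesis (fun j => h j * linform b j).
  (* The root equation turns [b = - Phi (1)] into [Phi (e^z(u) - 1)], which is
     [Phi ((1 + eta) z(u))]. *)
  have Eb : b = synthesis (fun j => (1 + h j) * linform u j).
    transitivity (synthesis (fun j => expform u j - 1)).
      by rewrite synthesisB u0 sub0r.
    by apply: eq_synthesis => j; rewrite mulrDl mul1r [h j * _]mulrC expdivE /expform; ring.
  transitivity (synthesis (fun j => linform v j + h j * linform v j)).
    by rewrite synthesisD synthK.
  transitivity (synthesis (fun j => linform b j + h j * linform b j) -
      synthesis (fun j => (1 + h j) * linform u j)).
    by rewrite -synthesisB; apply: eq_synthesis => j; rewrite /v !linformB; ring.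
  by rewrite -Eb synthesisD synthK addrAC subrr add0r.
have main e : hn (fun j => ((2 * e)%:C - h j) * linform v j) <= kap * N v ->
    (1 + 2 * e) * N v <= mu * kap * (N b + N v).
  move=> He.
  have Ev : (1 + (2 * e)%:C) *: v = synthesis (fun j => h j * linform b j) +
      synthesis (fun j => ((2 * e)%:C - h j) * linform v j).
    rewrite -E -addrA scalerDl scale1r; congr (_ + _).
    transitivity (synthesis (fun j => h j * linform v j + ((2 * e)%:C - h j) * linform v j)).
      transitivity (synthesis (fun j => (2 * e)%:C * linform v j)).
        by rewrite synthesisZ synthK.
      by apply: eq_synthesis => j; ring.
    by rewrite synthesisD.
  have : normc (1 + (2 * e)%:C) * N v <= mu * kap * (N b + N v).
    have -> : normc (1 + (2 * e)%:C) * N v = N ((1 + (2 * e)%:C) *: v).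
      by rewrite -wnormZ; apply: eq_wnorm => j; rewrite linformZ.
    rewrite Ev; apply: (le_trans (wnorm_linformD _ _)).
    have le_b := le_trans (synth_bound (fun j => h j * linform b j))
      (ler_wpM2l mu_ge0 (hw b)).
    have le_v := le_trans (synth_bound (fun j => ((2 * e)%:C - h j) * linform v j))
      (ler_wpM2l mu_ge0 He).
    apply: (le_trans (lerD le_b le_v)).
    by rewrite (_ : forall a c y z : R, a * (c * y) + a * (c * z) = a * c * (y + z));
      [exact: lexx|move=> *; ring].
  apply: le_trans; rewrite ler_wpM2r ?wnorm_linform_ge0// -(rmorph1 (real_complex R)) -rmorphD.
  by rewrite normc_real ler_norm.
have [Nv0|Nv_neq0] := eqVneq (N v) 0.
  have v0 := wnorm_linform_eq0 Nv0.
  rewrite big1 => [|j _]; last first.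
    have -> : linform v j = 0 by rewrite v0 linform0.
    by rewrite /cabs2 /= expr0n addr0 !mulr0.
  by rewrite mulr_ge0 ?sqr_ge0// (le_trans ler01).
have Nv_gt0 : 0 < N v by rewrite lt_def Nv_neq0 wnorm_linform_ge0.
pose e := (\sum_j p j * (complex.Re (h j) * cabs2 (linform v j))) / N v ^+ 2.
have eE : \sum_j p j * (complex.Re (h j) * cabs2 (linform v j)) = e * N v ^+ 2.
  by rewrite divfK// sqrf_eq0.
have main_e : (1 + 2 * e) * N v <= mu * kap * (N b + N v).
  by apply: main; rewrite (wnorm_reflection p_ge0 eE).
have main_0 : N v <= mu * kap * (N b + N v).
  have := main 0; rewrite !mulr0 addr0 mul1r; apply.
  rewrite (_ : hn _ = hn (fun j => h j * linform v j))//.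
  by apply: wnorm_isometric => j; rewrite sub0r mulNr normcN.
have mk0 : 0 <= mu * kap := mulr_ge0 mu_ge0 kap0.
apply: (@le_trans _ _ ((A + 4 * e) * N v ^+ 2)).
  rewrite mulrDl -[4 * e * _]mulrA -eE (wnorm2 p_ge0) !mulr_sumr -big_split /=.
  apply: ler_sum => j _.
  have -> : A * (p j * cabs2 (linform v j)) +
      4 * (p j * (complex.Re (h j) * cabs2 (linform v j))) =
      p j * ((A + 4 * complex.Re (h j)) * cabs2 (linform v j)) by ring.
  apply: ler_wpM2l => //; apply: ler_wpM2r; first exact: cabs2_ge0.
  exact: Ale.
exact: distorted_square_le A1 (wnorm_linform_ge0 v) (wnorm_linform_ge0 b) mk0 mut main_0 main_e.
Qed.

End ExponentialNewton.

Lemma contraction_constant (R : realType) (X Y : R) : 0 <= Y ->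
  3/7 * X <= 8/25 * (8/9 * Y) -> X <= 3/4 * Y.
Proof. lra. Qed.

(** * Numerical inequalities for [alpha], [T] and [theta] *)

Section Constants.
Variable R : realType.
Variable alpha : R.
Hypothesis alpha_gt0 : 0 < alpha.
Hypothesis alpha_le : alpha <= (13 - 3 * Num.sqrt 17) / 4.

(** [235/57] is a rational lower bound of [sqrt 17], chosen so that
    [(13 - 3 (235/57)) / 4 = 3/19]. *)
Lemma alpha_num : alpha <= 3/19.
Proof.
apply: (le_trans alpha_le).
have : 235/57 <= Num.sqrt (17 : R).
  rewrite -[X in X <= _]ger0_norm; last lra.
  by rewrite -sqrtr_sqr ler_wsqrtr//; lra.
lra.
Qed.

(* [alpha_radius = 2 alpha theta], where [theta] is the smallest root of the
   majorant [1 - theta + 3 alpha theta^2 / (3 - 2 alpha theta)] obtained from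
   the Pade bound of the exponential. *)
Definition alpha_radius :=
  ((3 + 2 * alpha) - Num.sqrt ((3 + 2 * alpha) ^+ 2 - 60 * alpha)) / 5.
Local Notation T := alpha_radius.

Lemma alpha_radius_le : T <= 5/12.
Proof.
have a1 := alpha_num; have a0 := alpha_gt0.
have : 11/12 + 2 * alpha <= Num.sqrt ((3 + 2 * alpha) ^+ 2 - 60 * alpha).
  rewrite -[X in X <= _]ger0_norm; last lra.
  by rewrite -sqrtr_sqr ler_wsqrtr//; lra.
rewrite /alpha_radius; lra.
Qed.

Lemma alpha_radiusE : 4 * (3 - T) * alpha = T * (6 - 5 * T).
Proof.
have a1 := alpha_num; have a0 := alpha_gt0; rewrite /alpha_radius.
have /sqr_sqrtr : 0 <= (3 + 2 * alpha) ^+ 2 - 60 * alpha by nra.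
set s := Num.sqrt _ => sE; lra.
Qed.

Lemma alpha_radius_gt0 : 0 < T.
Proof.
have := alpha_radiusE; have := alpha_radius_le; have a0 := alpha_gt0 => T1 TE.
rewrite ltNge; apply/negP => T0.
have : 0 < 4 * (3 - T) * alpha by rewrite !mulr_gt0//; lra.
by rewrite TE; nra.
Qed.

(** [theta] is [T / (2 alpha)], see [alpha_ratio_radius]; eliminating [alpha] by [alpha_radiusE]
    gives a rational function of [T] alone. *)
Definition alpha_ratio := 2 * (3 - T) / (6 - 5 * T).
Local Notation theta := alpha_ratio.

Let T0 := alpha_radius_gt0.
Let T1 := alpha_radius_le.
Let TE := alpha_radiusE.

Lemma alpha_ratioM : theta * (6 - 5 * T) = 2 * (3 - T).
Proof. by rewrite divfK// gt_eqF//; have := T1; lra. Qed.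

Lemma alpha_ratio_radius : 2 * alpha * theta = T.
Proof.
have d : 6 - 5 * T != 0 by rewrite gt_eqF//; have := T1; lra.
apply: (mulIf d); rewrite -[LHS]mulrA alpha_ratioM -TE; ring.
Qed.

(** The radius is a fixed point of the majorant, [1 + (pade_rate T) theta = theta], so the estimates
    map the ball of radius [theta beta] into itself with no loss. *)
Lemma pade_rate_radius : pade_rate T * theta = theta - 1.
Proof. by rewrite /pade_rate /alpha_ratio; have := T1 => T1'; field; lra. Qed.

Lemma pade_rate_radius_lt1 : pade_rate T < 1.
Proof. by rewrite /pade_rate ltr_pdivrMr; have := T1; lra. Qed.

Lemma alpha_ratio_pade :
  pade_rate T / (1 - pade_rate T) = theta - 1.
Proof.
have d : 1 - pade_rate T != 0 by rewrite gt_eqF// subr_gt0 pade_rate_radius_lt1.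
by apply: (mulIf d); rewrite divfK//; have := pade_rate_radius; lra.
Qed.

Lemma alpha_ratio_bounds : 1 <= theta /\ theta - 1 <= 8/25.
Proof.
have := alpha_ratioM; have := T0; have := T1; nra.
Qed.

Lemma expR_sub1_le (t : R) : 0 <= t < 3 -> expR t - 1 <= t * (1 + pade_rate t).
Proof.
move=> t0; have := exp_rem2_pade t0.
rewrite /exp_rem !exp_taylorS /exp_taylor big_ord0 add0r expr0 !divr1 expr1.
rewrite /pade_rate; lra.
Qed.

(** [pade_rate t / t] increases with [t], so a factor [mu >= 1] can be moved inside the argument. *)
Lemma mul_pade_rate_le (mu t r : R) : 1 <= mu -> 0 <= t -> mu * t <= r -> r < 3 ->
  mu * pade_rate t <= pade_rate r.
Proof.
move=> mu1 t0 tr r3; have tr' : t <= r by nra.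
rewrite /pade_rate mulrA ler_pdivrMr; last lra.
rewrite [leRHS]mulrAC ler_pdivlMr; last lra.
have -> : mu * (3 * t) * (2 * (3 - r)) = 6 * (mu * t) * (3 - r) by ring.
have -> : 3 * r * (2 * (3 - t)) = 6 * r * (3 - t) by ring.
have : 0 <= mu * t by rewrite mulr_ge0//; lra.
have := @ler_pM _ (mu * t) r (3 - r) (3 - t).
move=> H m0; have := H m0; lra.
Qed.

Lemma mul_expR_sub1_le (mu t r : R) : 1 <= mu -> 0 <= t -> mu * t <= r -> r < 3 ->
  mu * (expR t - 1) <= r * (1 + pade_rate r).
Proof.
move=> mu1 t0 tr r3; have tr' : t <= r by nra.
have t3 : 0 <= t < 3 by lra.
apply: (@le_trans _ _ (mu * (t * (1 + pade_rate t)))).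
  by apply: ler_wpM2l; [lra|exact: expR_sub1_le].
rewrite mulrA; apply: ler_pM => //; first by rewrite mulr_ge0//; lra.
- by have := pade_rate_ge0 t3; lra.
- by rewrite lerD2l pade_rate_le// t0.
Qed.

Lemma newton_radius_le : T + alpha / 5 <= 9/20.
Proof. by have := T1; have := alpha_num; lra. Qed.

Lemma pade_rate_radius_le : pade_rate T <= 1/4.
Proof. by rewrite /pade_rate ler_pdivrMr; have := T1; lra. Qed.

Lemma expR_radius_le : expR T <= 25/16.
Proof.
have t3 : 0 <= T < 3 by have := T0; have := T1; lra.
have := expR_sub1_le t3; have := pade_rate_radius_le.
have := T0; have := T1; nra.
Qed.

Lemma newton_contraction (mu nu beta t e e' : R) : 1 <= mu -> 0 <= nu ->
  0 < beta -> beta * mu * nu <= 2 * alpha -> 0 <= t -> mu * t <= T + alpha / 5 ->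
  0 <= e -> e <= 8/25 * beta ->
  (1 - mu * (expR t - 1)) * e' <= mu * (expR t * (pade_rate (nu * e) * e)) ->
  e' * beta <= 3/4 * e ^+ 2.
Proof.
move=> mu1 nu0 beta0 bmn t0 tle e0 ele le_e'.
have tle' : mu * t <= 9/20 := le_trans tle newton_radius_le.
have E1 : mu * (expR t - 1) <= 4/7.
  apply: (le_trans (mul_expR_sub1_le mu1 t0 tle' _)); first by lra.
  have -> : pade_rate (9/20 : R) = 9/34 by rewrite /pade_rate; field.
  lra.
have expt : 0 <= expR t - 1 by rewrite subr_ge0 -expR0 ler_expR.
have E2 : expR t <= 8/5 by nra.
have bmn' : beta * mu * nu <= 8/25 by have := alpha_num; lra.
have bn : beta * nu <= 8/25.
  by apply: le_trans bmn'; rewrite mulrAC ler_peMr// mulr_ge0// ltW.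
have ne0 : 0 <= nu * e by rewrite mulr_ge0.
have ne : nu * e <= 1/9.
  apply: (@le_trans _ _ (nu * (8/25 * beta))); first by rewrite ler_wpM2l.
  lra.
have P : pade_rate (nu * e) <= 5/9 * (nu * e).
  rewrite /pade_rate ler_pdivrMr; last lra.
  nra.
have Q : (1 - mu * (expR t - 1)) * e' <= mu * (8/5 * (5/9 * (nu * e) * e)).
  apply: (le_trans le_e'); apply: ler_wpM2l; first lra.
  apply: ler_pM => //; last by rewrite ler_wpM2r.
  by rewrite mulr_ge0// pade_rate_ge0// ne0; lra.
have [e'0|e'0] := lerP e' 0.
  apply: (@le_trans _ _ 0); first by rewrite mulr_le0_ge0// ltW.
  by rewrite mulr_ge0 ?sqr_ge0//; lra.
have Q2 : 3/7 * e' <= mu * (8/5 * (5/9 * (nu * e) * e)).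
  by apply: le_trans Q; apply: ler_wpM2r; [exact: ltW|lra].
have Q3 : 3/7 * e' * beta <= (beta * mu * nu) * (8/9 * e ^+ 2).
  apply: (@le_trans _ _ (mu * (8/5 * (5/9 * (nu * e) * e)) * beta)).
    by rewrite ler_wpM2r// ltW.
  lra.
have e2 : 0 <= e ^+ 2 by rewrite sqr_ge0.
have Q4 : (beta * mu * nu) * (8/9 * e ^+ 2) <= 8/25 * (8/9 * e ^+ 2).
  by apply: ler_wpM2r bmn'; apply: mulr_ge0 e2; exact: divr_ge0.
have := le_trans Q3 Q4; rewrite -[leLHS]mulrA.
exact: contraction_constant e2.
Qed.

(** [A] of the overview: the bound of [expR2_le] at [r = T], without its [eta] term. *)
Definition metric_distortion := 1 + 4/3 * T ^+ 2 + 221/105 * T ^+ 3.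

Lemma sqrt_metric_distortion_le :
  Num.sqrt metric_distortion <= 1 + (2/3 * T ^+ 2 + 221/210 * T ^+ 3).
Proof.
set m := 2/3 * _ + _; have := T0 => T0'.
have m0 : 0 <= m.
  by apply: addr_ge0; apply: mulr_ge0; [lra|exact: exprn_ge0 (ltW T0')|lra|exact: exprn_ge0 (ltW T0')].
have m1 : 1 + m = Num.sqrt ((1 + m) ^+ 2) by rewrite sqrtr_sqr ger0_norm// addr_ge0.
rewrite [leRHS]m1 ler_wsqrtr//.
rewrite /metric_distortion sqrrD expr1n mul1r.
have -> : m *+ 2 = 4/3 * T ^+ 2 + 221/105 * T ^+ 3 by rewrite /m; lra.
by rewrite !addrA lerDl sqr_ge0.
Qed.

Local Notation r0 := ((1 + alpha - Num.sqrt (1 - 6 * alpha + alpha ^+ 2)) / (4 * alpha)).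
Local Notation r1 := ((1 - 3 * alpha - Num.sqrt (1 - 6 * alpha + alpha ^+ 2)) / (4 * alpha)).

Lemma r0E : r0 = 1 + r1.
Proof. by field; rewrite gt_eqF. Qed.

(** [r1] is the smaller root of [alpha (1 + y) (1 + 2 y) = y]; the condition [y <= 2/5] puts [y] to
    the left of the vertex of this quadratic. *)
Lemma le_r1 (y : R) : y <= 2/5 -> y <= alpha * (1 + y) * (1 + 2 * y) -> y <= r1.
Proof.
move=> y1 yle; have a1 := alpha_num; have a0 := alpha_gt0.
rewrite ler_pdivlMr ?mulr_gt0//.
suff : Num.sqrt (1 - 6 * alpha + alpha ^+ 2) <= 1 - 3 * alpha - 4 * alpha * y by lra.
have g0 : 0 <= 1 - 3 * alpha - 4 * alpha * y by nra.
rewrite -[leRHS]ger0_norm// -sqrtr_sqr ler_wsqrtr//.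
have : 0 <= 8 * alpha * (alpha * (1 + y) * (1 + 2 * y) - y).
  by rewrite mulr_ge0 ?subr_ge0// mulr_ge0// ltW.
lra.
Qed.

(** The inequality behind (c) and (d). The test of [le_r1] is multiplied by [4 (3 - T) (6 - 5 T)],
    so that [TE] removes [alpha]; the terms of order [T] cancel and [T^2] factors out. *)
Lemma distorted_ratio_le :
  Num.sqrt metric_distortion * (theta - 1) <= 2/5 /\
  Num.sqrt metric_distortion * (theta - 1) <= r1.
Proof.
set M := 1 + (2/3 * T ^+ 2 + 221/210 * T ^+ 3).
have th1 : 0 <= theta - 1 by have [] := alpha_ratio_bounds; lra.
have T0' := T0; have T1' := T1.
have d0 : 0 < 6 - 5 * T by lra.
have M1 : M <= 6/5.
  rewrite /M; have : T ^+ 2 <= (5/12) ^+ 2 by rewrite lerXn2r ?nnegrE; lra.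
  have : T ^+ 3 <= (5/12) ^+ 3 by rewrite lerXn2r ?nnegrE; lra.
  lra.
set y := M * (theta - 1).
have yM : y * (6 - 5 * T) = 3 * T * M.
  have := alpha_ratioM; rewrite /y -mulrA mulrBl => ->; ring.
have le_y : Num.sqrt metric_distortion * (theta - 1) <= y.
  by rewrite ler_wpM2r// sqrt_metric_distortion_le.
have y25 : y <= 2/5.
  by have [_ th2] := alpha_ratio_bounds; rewrite /y; nra.
split; first exact: le_trans le_y y25.
apply: (le_trans le_y); apply: le_r1 => //.
rewrite -(ler_pM2r d0) yM.
have dT : 0 < 4 * (3 - T) by lra.
rewrite -(ler_pM2l dT).
have -> : 4 * (3 - T) * (alpha * (1 + y) * (1 + 2 * y) * (6 - 5 * T)) =
   T * ((1 + y) * (6 - 5 * T)) * ((1 + 2 * y) * (6 - 5 * T)).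
  rewrite -[in RHS]mulrA; have := TE => TE'.
  transitivity ((4 * (3 - T) * alpha) * ((1 + y) * (1 + 2 * y) * (6 - 5 * T))).
    by ring.
  by rewrite TE'; ring.
have -> : (1 + y) * (6 - 5 * T) = 6 - 5 * T + 3 * T * M by rewrite -yM; ring.
have -> : (1 + 2 * y) * (6 - 5 * T) = 6 - 5 * T + 6 * T * M.
  transitivity (6 - 5 * T + 2 * (y * (6 - 5 * T))); first ring.
  by rewrite yM; ring.
rewrite -subr_ge0.
set m := 2/3 * T + 221/210 * T ^+ 2.
have -> : T * (6 - 5 * T + 3 * T * M) * (6 - 5 * T + 6 * T * M) -
    4 * (3 - T) * (3 * T * M) =
  T ^+ 2 * (6 - 2 * T + m * (66 * T - 9 * T ^+ 2 - 36) + 18 * T ^+ 3 * m ^+ 2).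
  by rewrite /M /m; field.
apply: mulr_ge0; first exact: sqr_ge0.
have q1 : 0 <= 18 * T ^+ 3 * m ^+ 2.
  by rewrite mulr_ge0 ?sqr_ge0// mulr_ge0// exprn_ge0// ltW.
(* On this range the remaining polynomial has its minimum near [T = 7/20]; the third root [- 7/10]
   makes the square term of the cubic vanish. *)
have q2 : 0 <= (T - 7/20) ^+ 2 * (T + 7/10).
  by rewrite mulr_ge0 ?sqr_ge0//; lra.
have q3 := sqr_ge0 (T - 7/20).
have q4 : 0 <= T ^+ 3 * (5/12 - T).
  by rewrite mulr_ge0 ?subr_ge0// exprn_ge0// ltW.
rewrite /m in q1 *; lra.
Qed.

End Constants.

(** * Norms of columns, and differentials identified by quadratic remainders *)

Section ColumnNorm.
Variables (R : realType) (n : nat).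
Local Notation C := R[i].
Local Notation Cn := 'cV[C]_n.
Implicit Types w : Cn.

(** The norm of a column is the maximum of the moduli, with values in [C]; this is the same number
    in [R]. *)
Definition rnorm w : R := complex.Re `|w|.

Lemma rnormE w : `|w| = (rnorm w)%:C.
Proof. by rewrite RRe_real// ger0_real. Qed.

Lemma normcEC (z : C) : `|z| = (normc z)%:C.
Proof. by case: z. Qed.

Lemma coord_le_norm w i : `|w i 0| <= `|w|.
Proof.
change (((`|w i 0|%:nng)%:num : C) <= mx_norm w); rewrite mx_normE num_le.
exact: (le_bigmax _ (fun ij => `|w ij.1 ij.2|%:nng) (i, 0)).
Qed.

Lemma norm_le_coord w (M : C) : 0 <= M -> (forall i, `|w i 0| <= M) -> `|w| <= M.
Proof.
move=> M0 wM; have [w0|/mx_norm_neq0[[i j] E]] := eqVneq (mx_norm w) 0.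
  by change (mx_norm w <= M); rewrite w0.
by change (mx_norm w <= M); rewrite E ord1.
Qed.

Lemma rnorm_ge0 w : 0 <= rnorm w.
Proof. by have := normr_ge0 w; rewrite rnormE lecR. Qed.

Lemma coord_le_rnorm w i : normc (w i 0) <= rnorm w.
Proof. by have := coord_le_norm w i; rewrite rnormE normcEC lecR. Qed.

Lemma mulmx_continuous (D : 'M[C]_n) : continuous (mulmx D : Cn -> Cn).
Proof.
apply/linear_bounded_continuous/bounded_funP => r.
exists (\sum_i \sum_j `|D i j| * r) => w wr.
have r0 : 0 <= r := le_trans (normr_ge0 _) wr.
apply: norm_le_coord => [|i].
  by apply: sumr_ge0 => i _; apply: sumr_ge0 => j _; rewrite mulr_ge0.
rewrite mxE; apply: (le_trans (ler_norm_sum _ _ _)).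
rewrite [leRHS](bigD1 i)//= -[leLHS]addr0; apply: lerD; last first.
  by apply: sumr_ge0 => k _; apply: sumr_ge0 => j _; rewrite mulr_ge0.
apply: ler_sum => j _; rewrite normrM ler_wpM2l//.
exact: le_trans (coord_le_norm _ _) wr.
Qed.

Lemma diff_of_quadratic_remainder (G : Cn -> Cn) (D : 'M[C]_n) (u : Cn) (K d : R) :
  0 <= K -> 0 < d ->
  (forall w i, rnorm w < d ->
    normc ((G (w + u) - G u - D *m w) i 0) <= K * rnorm w ^+ 2) ->
  'd G u = mulmx D :> (Cn -> Cn).
Proof.
move=> K0 d0 rem; apply: diff_unique; first exact: mulmx_continuous.
apply/eqaddoP => eps eps0.
have epsE : eps = (complex.Re eps)%:C by rewrite RRe_real// gtr0_real.
have e0 : 0 < complex.Re eps by move: eps0; rewrite epsE ltcR.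
have K1 : 0 < K + 1 by rewrite ltr_wpDl.
suff : \forall w \near (0 : Cn),
  `|(G \o shift u - (cst (G u) + mulmx D)) w| <= eps * `|w| by [].
apply/nbhs_norm0P; exists (Num.min d (complex.Re eps / (K + 1)))%:C.
  by rewrite /mkset ltcR lt_min d0 divr_gt0.
move=> w we'; have : rnorm w < Num.min d (complex.Re eps / (K + 1)).
  by rewrite -ltcR -rnormE.
rewrite lt_min => /andP[wd we].
rewrite [leRHS](_ : _ = (complex.Re eps * rnorm w)%:C); last first.
  by rewrite rnormE [X in X * _ = _]epsE -rmorphM.
apply: norm_le_coord => [|i]; first by rewrite lecR mulr_ge0 ?rnorm_ge0// ltW.
rewrite normcEC lecR.
have -> : (G \o shift u - (cst (G u) + mulmx D)) w = G (w + u) - G u - D *m w.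
  by rewrite !fctE opprD addrA.
apply: (le_trans (rem _ _ wd)); rewrite expr2 mulrA ler_wpM2r ?rnorm_ge0//.
move: we; rewrite ltr_pdivlMr//; have := rnorm_ge0 w; lra.
Qed.

End ColumnNorm.

(** * Coordinates of a system at a point *)

Section SystemCoordinates.
Variables (R : realType) (n : nat) (A : 'I_n -> {fset 'rV[R]_n}).
Hypothesis A_neq0 : forall i, A i != fset0.
Variable rho : forall i, A i -> R.
Hypothesis rho_gt0 : forall i (a : A i), 0 < rho a.
Local Notation C := R[i].
Local Notation Cn := 'cV[C]_n.
Implicit Types (x u w : Cn).

Lemma pairingD (a : 'rV[R]_n) u w : pairing a (u + w) = pairing a u + pairing a w.
Proof. by rewrite /pairing mulmxDr mxE. Qed.

Lemma pairingBl (a b : 'rV[R]_n) u : pairing (a - b) u = pairing a u - pairing b u.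
Proof. by rewrite /pairing map_mxB mulmxBl !mxE. Qed.

Lemma pairingZl (r : R) (a : 'rV[R]_n) u : pairing (r *: a) u = r%:C * pairing a u.
Proof. by rewrite /pairing map_mxZ -scalemxAl mxE. Qed.

Lemma pairing_sumr (I : finType) (F : I -> 'rV[R]_n) u :
  pairing (\sum_i F i) u = \sum_i pairing (F i) u.
Proof. by rewrite /pairing raddf_sum mulmx_suml summxE. Qed.

Lemma kerK_gt0 i x : 0 < kerK rho i x.
Proof.
have [a0 a0A] := fset0Pn _ (A_neq0 i).
rewrite /kerK (bigD1 [` a0A]%fset)//= ltr_wpDr//; last first.
  by rewrite mulr_gt0 ?expR_gt0 ?exprn_gt0.
by apply: sumr_ge0 => a _; rewrite mulr_ge0 ?expR_ge0 ?sqr_ge0.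
Qed.

Lemma weight_gt0 i x (a : A i) : 0 < weight rho x a.
Proof. by rewrite divr_gt0 ?kerK_gt0// mulr_gt0 ?expR_gt0 ?exprn_gt0. Qed.

Lemma weight_sum i x : \sum_(a : A i) weight rho x a = 1.
Proof. by rewrite -mulr_suml divff// gt_eqF// kerK_gt0. Qed.

(** The momentum is the barycentre of the exponents for the weights; this kills the linear terms
    when metrics at two points are compared. *)
Lemma weight_centered i x u :
  \sum_(a : A i) (weight rho x a)%:C * pairing (val a - momentum rho i x) u = 0.
Proof.
under eq_bigr do rewrite pairingBl mulrBr -pairingZl.
rewrite big_split /= -pairing_sumr -/(momentum rho i x) sumrN -mulr_suml.
by rewrite -rmorph_sum weight_sum mul1r subrr.
Qed.

(** The factor in [evalW] centres the exponents: translating the argument by [u] multiplies each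
    term by [e^z_a(u)]. *)
Lemma evalW_shift i x u (a : A i) :
  evalW rho x (x + u) a =
  evalW rho x x a * cexp (pairing (val a - momentum rho i x) u).
Proof.
rewrite /evalW /evalV !pairingD pairingBl opprD !cexpD; ring.
Qed.

Lemma cabs2_evalW i x (a : A i) : cabs2 (evalW rho x x a) =
  weight rho x a * (kerK rho i x *
    expR (- complex.Re (pairing (momentum rho i x) x)) ^+ 2).
Proof.
rewrite cabs2E /evalW /evalV !normcM !normc_cexp Re_oppc normc_real.
rewrite !exprMn real_normK ?num_real// [RHS]mulrA /weight divfK; last first.
  by rewrite gt_eqF// kerK_gt0.
have -> : expR (2 * complex.Re (pairing (val a) x)) =
    expR (complex.Re (pairing (val a) x)) ^+ 2.
  by rewrite mulr_natl mulr2n expRD.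
ring.
Qed.

Lemma normW2 i x : normW rho i x ^+ 2 =
  kerK rho i x * expR (- complex.Re (pairing (momentum rho i x) x)) ^+ 2.
Proof.
rewrite sqr_sqrtr; last by apply: sumr_ge0 => a _; exact: cabs2_ge0.
by under eq_bigr do rewrite cabs2_evalW; rewrite -mulr_suml weight_sum mul1r.
Qed.

Lemma normW_gt0 i x : 0 < normW rho i x.
Proof.
rewrite lt_def sqrtr_ge0 andbT -sqrf_eq0 normW2 gt_eqF//.
by rewrite mulr_gt0 ?kerK_gt0// exprn_gt0// expR_gt0.
Qed.

Variables (f : system A) (x : Cn).

Definition local_coef i (a : A i) : C :=
  (normW rho i x)^-1%:C * (f i a * evalW rho x x a).

(** Source of the weights [p_a]: after normalisation the coefficients have squared modulus
    [|f_a|^2 p_a], which pairs [coef_norm] with the weighted norm in Cauchy-Schwarz. *)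
Lemma cabs2_local_coef i (a : A i) :
  cabs2 (local_coef a) = cabs2 (f i a) * weight rho x a.
Proof.
have cabs2M (z w : C) : cabs2 (z * w) = cabs2 z * cabs2 w.
  by rewrite !cabs2E normcM exprMn.
rewrite /local_coef 2!cabs2M cabs2_evalW cabs2E -normW2 normc_real real_normK ?num_real// exprVn.
by field; rewrite gt_eqF// normW_gt0.
Qed.

Definition local_index : finType := {i : 'I_n & A i}.
Local Notation J := local_index.
Definition local_weight (j : J) : R := weight rho x (tagged j).
Definition local_row (j : J) : 'rV[C]_n :=
  map_mx (real_complex R) (val (tagged j) - momentum rho (tag j) x).

Definition coef_sum (y : J -> C) : Cn :=
  \col_i \sum_(a : A i) local_coef a * y (Tagged (fun i => A i) a).

Local Notation lin := (linform local_row).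
Local Notation expf := (expform local_row).

Lemma newtSE u : newtS rho f x u = coef_sum (expf u).
Proof.
apply/colP => i; rewrite !mxE mulr_sumr; apply: eq_bigr => a _.
by rewrite evalW_shift /local_coef !mulrA.
Qed.

Lemma lnormE w : lnorm rho x w = wnorm local_weight (lin w).
Proof.
rewrite /lnorm /wnorm; congr Num.sqrt.
transitivity (\sum_i \sum_(a : A i)
    weight rho x a * cabs2 (pairing (val a - momentum rho i x) w)).
  apply: eq_bigr => i _; rewrite sqr_sqrtr// sumr_ge0// => a _.
  by rewrite mulr_ge0 ?cabs2_ge0// ltW// weight_gt0.
by rewrite (@sig_big_dep _ _ _ _ _ xpredT (fun _ => xpredT)
  (fun i a => weight rho x a * cabs2 (pairing (val a - momentum rho i x) w))).
Qed.

Lemma local_weight_ge0 j : 0 <= local_weight j.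
Proof. exact/ltW/weight_gt0. Qed.

Definition newt_jacobian u : 'M[C]_n :=
  \matrix_(i, k) \sum_(a : A i) local_coef a *
    (expf u (Tagged (fun i => A i) a) * local_row (Tagged (fun i => A i) a) 0 k).

Lemma newt_jacobianM u w :
  newt_jacobian u *m w = coef_sum (fun j => expf u j * lin w j).
Proof.
apply/colP => i; rewrite !mxE.
under eq_bigr do rewrite mxE mulr_suml.
rewrite exchange_big /=; apply: eq_bigr => a _.
rewrite /linform mxE !mulr_sumr; apply: eq_bigr => k _; ring.
Qed.

Definition row_bound (j : J) : R := \sum_k normc (local_row j 0 k).

Lemma normc_linform_le j w : normc (lin w j) <= row_bound j * rnorm w.
Proof.
rewrite /linform mxE mulr_suml; apply: (le_trans (normc_sum _)).
by apply: ler_sum => k _; rewrite normcM ler_wpM2l ?normc_ge0// coord_le_rnorm.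
Qed.

Lemma newtDSE u : newtDS rho f x u = newt_jacobian u.
Proof.
set L := \sum_j row_bound j.
have b0 j : 0 <= row_bound j by apply: sumr_ge0 => k _; exact: normc_ge0.
have L0 : 0 <= L by apply: sumr_ge0.
pose K := \sum_i \sum_(a : A i)
  normc (local_coef a * expf u (Tagged (fun i => A i) a)) * L ^+ 2.
have L1 : 0 < 1 + L by rewrite ltr_pwDl.
have E : 'd (newtS rho f x) u = mulmx (newt_jacobian u) :> (Cn -> Cn).
  (* For [|w| < 1 / (1 + L)] all [|z_j(w)|] are at most 1, and there the Pade bound is below
     [|z_j(w)|^2]. *)
  apply: (@diff_of_quadratic_remainder _ _ _ _ _ K (1 + L)^-1).
  - by apply: sumr_ge0 => i _; apply: sumr_ge0 => a _; rewrite mulr_ge0 ?normc_ge0 ?sqr_ge0.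
  - by rewrite invr_gt0.
  move=> w i wd; rewrite !newtSE newt_jacobianM !mxE -!sumrB.
  apply: (le_trans (normc_sum _)); rewrite /K mulr_suml.
  rewrite (bigD1 i)//= -[leLHS]addr0; apply: lerD; last first.
    apply: sumr_ge0 => k _; rewrite mulr_ge0 ?sqr_ge0//.
    by apply: sumr_ge0 => a _; rewrite mulr_ge0 ?normc_ge0 ?sqr_ge0.
  rewrite mulr_suml; apply: ler_sum => a _; set j : J := Tagged (fun i => A i) a.
  have -> : local_coef a * expf (w + u) j - local_coef a * expf u j -
      local_coef a * (expf u j * lin w j) =
      local_coef a * expf u j * (expf w j - 1 - lin w j).
    by rewrite /expform linformD cexpD; ring.
  rewrite (normcM (local_coef a * expf u j)) -[leRHS]mulrA.
  apply: ler_wpM2l; first exact: normc_ge0.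
  rewrite -exprMn.
  have wL : normc (lin w j) <= L * rnorm w.
    apply: (le_trans (normc_linform_le _ _)); rewrite ler_wpM2r ?rnorm_ge0//.
    by rewrite /L (bigD1 j)//= lerDl sumr_ge0.
  have w1 : normc (lin w j) <= 1.
    apply: (le_trans wL); move: wd; rewrite -div1r ltr_pdivlMr//.
    have := rnorm_ge0 w; nra.
  have zc := normc_ge0 (lin w j).
  apply: (le_trans (normc_cexp_rem2 _)); first by lra.
  have LR : 0 <= L * rnorm w := le_trans zc wL.
  apply: (@le_trans _ _ (normc (lin w j) ^+ 2)); last by rewrite lerXn2r.
  rewrite expr2 ler_wpM2l// /pade_rate ler_pdivrMr; last lra.
  nra.
by apply/matrixP => i k; rewrite !mxE E -colE !mxE.
Qed.

End SystemCoordinates.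

(** * The invariants [beta], [mu] and [nu] as bounds for [Phi] and [z] *)

Section LocalInvariants.
Variables (R : realType) (n : nat) (A : 'I_n -> {fset 'rV[R]_n}).
Hypothesis A_neq0 : forall i, A i != fset0.
Variable rho : forall i, A i -> R.
Hypothesis rho_gt0 : forall i (a : A i), 0 < rho a.
Local Notation C := R[i].
Local Notation Cn := 'cV[C]_n.
Implicit Types (u w v : Cn).
Variables (f : system A) (x : Cn).
Hypothesis f_neq0 : forall i, f i != 0.
Local Notation D := (newtDS rho f x 0).
Hypothesis D_unit : D \in unitmx.
Local Notation J := (local_index A).
Local Notation p := (local_weight rho x).
Local Notation l := (local_row rho x).
Local Notation N w := (wnorm p (linform l w)).

Definition local_synth (j : J) : Cn :=
  local_coef rho f x (tagged j) *: (invmx D *m delta_mx (tag j) 0).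
Local Notation synth := (synthesis local_synth).

Lemma local_synthE (y : J -> C) : synth y = invmx D *m coef_sum rho f x y.
Proof.
rewrite [coef_sum _ _ _ _]matrix_sum_delta mulmx_sumr.
under [RHS]eq_bigr do rewrite big_ord1 mxE scaler_suml mulmx_sumr.
rewrite (@sig_big_dep _ _ _ _ _ xpredT (fun _ => xpredT) (fun i a =>
  invmx D *m ((local_coef rho f x a * y (Tagged (fun i => A i) a)) *: delta_mx i 0))).
apply: eq_bigr => -[i a] _.
by rewrite /local_synth /= -scalemxAr scalerA mulrC.
Qed.

Lemma coef_sum_linform w : coef_sum rho f x (linform l w) = D *m w.
Proof.
rewrite newtDSE// newt_jacobianM; apply/colP => i; rewrite !mxE.
by apply: eq_bigr => a _; rewrite /expform linform0 cexp0 mul1r.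
Qed.

Lemma local_synthK w : synth (linform l w) = w.
Proof. by rewrite local_synthE coef_sum_linform mulKmx. Qed.

Lemma newtS_at0 : newtS rho f x 0 = coef_sum rho f x (fun=> 1).
Proof.
rewrite newtSE; apply/colP => i; rewrite !mxE; apply: eq_bigr => a _.
by rewrite /expform linform0 cexp0.
Qed.

Lemma betaE : beta rho f x = (N (- synth (fun=> 1)))%:E.
Proof.
rewrite /beta D_unit newtS_at0 -local_synthE lnormE//; congr (_%:E).
by rewrite wnorm_linformN.
Qed.

Lemma coef_norm_gt0 i : 0 < coef_norm f i.
Proof.
rewrite sqrtr_gt0 lt_def; apply/andP; split; last first.
  by apply: sumr_ge0 => a _; exact: cabs2_ge0.
apply: contra (f_neq0 i) => /eqP sum0; apply/eqP/ffunP => a; rewrite ffunE.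
have ge0 (c : A i) : true -> 0 <= cabs2 (f i c) by rewrite cabs2_ge0.
have := psumr_eq0P ge0 sum0 (i := a) isT.
by rewrite cabs2E => /eqP; rewrite sqrf_eq0 => /eqP/eq0_normc.
Qed.

Lemma normc_coef_sum (y : J -> C) i :
  normc (coef_sum rho f x y i 0) <= coef_norm f i *
    Num.sqrt (\sum_(a : A i) weight rho x a * cabs2 (y (Tagged (fun i => A i) a))).
Proof.
set Y := \sum_(a : A i) _.
have Y0 : 0 <= Y.
  by apply: sumr_ge0 => a _; rewrite mulr_ge0 ?cabs2_ge0// ltW// weight_gt0.
rewrite -(@ler_pXn2r _ 2) ?nnegrE ?mulr_ge0 ?sqrtr_ge0 ?normc_ge0// exprMn.
rewrite !sqr_sqrtr//; last by apply: sumr_ge0 => a _; exact: cabs2_ge0.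
pose w (a : A i) := Num.sqrt (weight rho x a).
have w2 a : w a ^+ 2 = weight rho x a by rewrite sqr_sqrtr// ltW// weight_gt0.
have := @sum_CauchySchwarz R (A i) (fun a => normc (f i a))
  (fun a => w a * normc (y (Tagged (fun i => A i) a))).
under [X in _ <= X * _]eq_bigr do rewrite -cabs2E.
under [X in _ <= _ * X]eq_bigr do rewrite exprMn w2 -cabs2E.
apply: le_trans; rewrite lerXn2r ?nnegrE ?normc_ge0//.
  by apply: sumr_ge0 => a _; rewrite !mulr_ge0 ?normc_ge0 ?sqrtr_ge0.
rewrite mxE; apply: (le_trans (normc_sum _)); apply: ler_sum => a _.
rewrite normcM mulrA ler_wpM2r ?normc_ge0//.
rewrite -(@ler_pXn2r _ 2) ?nnegrE ?mulr_ge0 ?sqrtr_ge0 ?normc_ge0//.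
by rewrite exprMn -!cabs2E cabs2_local_coef// w2.
Qed.

Lemma norm2_ge0 v : 0 <= norm2 v. Proof. exact: sqrtr_ge0. Qed.

Lemma norm2Z (r : R) v : 0 <= r -> norm2 (r%:C *: v) = r * norm2 v.
Proof.
move=> r0; rewrite -[r in RHS]ger0_norm// -sqrtr_sqr -sqrtrM ?sqr_ge0//.
congr Num.sqrt; rewrite mulr_sumr; apply: eq_bigr => i _.
by rewrite mxE cabs2E normcM normc_real exprMn -cabs2E real_normK ?num_real.
Qed.

Lemma norm2_eq0 v : norm2 v = 0 -> v = 0.
Proof.
move=> /eqP; rewrite sqrtr_eq0 => le0; apply/colP => i; rewrite mxE.
have ge0 (k : 'I_n) : true -> 0 <= cabs2 (v k 0) by rewrite cabs2_ge0.
have sum0 : \sum_k cabs2 (v k 0) = 0.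
  by apply/eqP; rewrite eq_le le0 sumr_ge0.
have := psumr_eq0P ge0 sum0 (i := i) isT.
by rewrite cabs2E => /eqP; rewrite sqrf_eq0 => /eqP/eq0_normc.
Qed.

Lemma wnorm_linformZ (r : R) v : 0 <= r -> N (r%:C *: v) = r * N v.
Proof.
move=> r0; rewrite (eq_wnorm _ (linformZ _ _ _)) wnormZ normc_real ger0_norm//.
Qed.

(** [mu] is the operator norm of [B]. Since no [f i] vanishes, [coef_sum y] is the diagonal matrix
    of the [|f_i|] applied to some [v], and Cauchy-Schwarz in each equation gives
    [norm2 v <= wnorm p y]. *)
Lemma mu_bound (M : R) : mu rho f x = M%:E ->
  forall y : J -> C, N (synth y) <= M * wnorm p y.
Proof.
rewrite /mu D_unit => muE y.
set B := invmx D *m diag_mx (\row_i (coef_norm f i)%:C).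
have sup_le v : norm2 v <= 1 -> N (B *m v) <= M.
  move=> v1; rewrite -lee_fin -muE -lnormE//; apply: ereal_sup_ubound.
  by exists v.
have B_le v : N (B *m v) <= M * norm2 v.
  have [v0|v0] := eqVneq (norm2 v) 0.
    rewrite v0 mulr0 (norm2_eq0 v0) mulmx0 wnorm_linform0//.
  have v_gt0 : 0 < norm2 v by rewrite lt_def v0 norm2_ge0.
  rewrite -ler_pdivrMr// mulrC -wnorm_linformZ ?invr_ge0 ?norm2_ge0// scalemxAr.
  by apply: sup_le; rewrite norm2Z ?invr_ge0 ?norm2_ge0// mulVf.
have M0 : 0 <= M.
  apply: le_trans (sup_le 0 _); first exact: wnorm_ge0.
  by rewrite -(scale0r 0) -(rmorph0 (real_complex R)) norm2Z// mul0r.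
pose v : Cn := \col_i ((coef_norm f i)^-1%:C * coef_sum rho f x y i 0).
have -> : synth y = B *m v.
  rewrite local_synthE /B -mulmxA; congr (_ *m _); apply/colP => i.
  rewrite mul_diag_mx !mxE mulrA -rmorphM divff ?mul1r//.
  by rewrite gt_eqF// coef_norm_gt0.
apply: (le_trans (B_le v)); rewrite ler_wpM2l//.
apply: ler_wsqrtr.
have -> : \sum_(j : J) p j * cabs2 (y j) = \sum_i \sum_(a : A i)
    weight rho x a * cabs2 (y (Tagged (fun i => A i) a)).
  rewrite (@sig_big_dep _ _ _ _ _ xpredT (fun _ => xpredT) (fun i (a : A i) =>
    weight rho x a * cabs2 (y (Tagged (fun i => A i) a)))).
  by apply: eq_bigr => -[i a] _.
apply: ler_sum => i _; rewrite mxE cabs2E normcM normc_real.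
have F0 := coef_norm_gt0 i.
rewrite ger0_norm; last by rewrite invr_ge0 ltW.
rewrite exprMn exprVn ler_pdivrMl ?exprn_gt0//.
set Y := \sum_(a : A i) _.
have Y0 : 0 <= Y.
  by apply: sumr_ge0 => a _; rewrite mulr_ge0 ?cabs2_ge0// ltW// weight_gt0.
rewrite -[Y]sqr_sqrtr// -exprMn lerXn2r ?nnegrE ?normc_ge0 ?mulr_ge0 ?sqrtr_ge0//.
exact: normc_coef_sum.
Qed.

Lemma lnormi_ge0 i u : 0 <= lnormi rho i x u. Proof. exact: sqrtr_ge0. Qed.

Lemma lnormi2 i u : lnormi rho i x u ^+ 2 =
  \sum_(a : A i) weight rho x a * cabs2 (pairing (val a - momentum rho i x) u).
Proof.
rewrite sqr_sqrtr// sumr_ge0// => a _.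
by rewrite mulr_ge0 ?cabs2_ge0// ltW// weight_gt0.
Qed.

Lemma lnormi_le_wnorm i u : lnormi rho i x u <= N u.
Proof.
rewrite -lnormE// -[leLHS]ger0_norm ?lnormi_ge0// -sqrtr_sqr ler_wsqrtr//.
by rewrite (bigD1 i)//= lerDl sumr_ge0// => k _; rewrite sqr_ge0.
Qed.

Lemma lnormi_eq0 i u : lnormi rho i x u = 0 ->
  forall a : A i, pairing (val a - momentum rho i x) u = 0.
Proof.
move=> u0 a; have := lnormi2 i u; rewrite u0 expr0n => /esym sum0.
have ge0 (c : A i) : true ->
    0 <= weight rho x c * cabs2 (pairing (val c - momentum rho i x) u).
  by rewrite mulr_ge0 ?cabs2_ge0// ltW// weight_gt0.
have /eqP := psumr_eq0P ge0 sum0 (i := a) isT.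
rewrite mulf_eq0 gt_eqF ?weight_gt0//= cabs2E sqrf_eq0 => /eqP.
exact: eq0_normc.
Qed.

Lemma pairingZ (a : 'rV[R]_n) (c : C) u : pairing a (c *: u) = c * pairing a u.
Proof. by rewrite /pairing -scalemxAr mxE. Qed.

Lemma lnormiZ i (r : R) u : 0 <= r ->
  lnormi rho i x (r%:C *: u) = r * lnormi rho i x u.
Proof.
move=> r0; rewrite -[r in RHS]ger0_norm// -sqrtr_sqr -sqrtrM ?sqr_ge0//.
congr Num.sqrt; rewrite mulr_sumr; apply: eq_bigr => a _.
by rewrite pairingZ cabs2E normcM normc_real exprMn -cabs2E real_normK ?num_real// mulrCA.
Qed.

Lemma le_nu i (a : A i) u : lnormi rho i x u <= 1 ->
  ((normc (pairing (val a - momentum rho i x) u))%:E <= nu rho x)%E.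
Proof.
move=> u1; rewrite normc_cabs2.
apply: le_trans (le_bigmax _ _ i); apply: le_trans (le_bigmax _ _ a).
by apply: ereal_sup_ubound; exists u.
Qed.

Lemma nu_bound (V : R) : nu rho x = V%:E ->
  forall w j, normc (linform l w j) <= V * N w.
Proof.
move=> nuE w [i a]; rewrite /linform /local_row /=.
rewrite -/(pairing (val a - momentum rho i x) w).
have V0 : 0 <= V.
  have := @le_nu i a 0; rewrite nuE lee_fin => V_le.
  apply: le_trans (V_le _); first exact: normc_ge0.
  by rewrite -(scale0r 0) -(rmorph0 (real_complex R)) lnormiZ// mul0r.
apply: (@le_trans _ _ (V * lnormi rho i x w)); last first.
  by rewrite ler_wpM2l// lnormi_le_wnorm.
(* A vector of seminorm 0 cannot be normalised, but then positivity of the weights makes all the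
   forms of the [i]-th equation vanish on it. *)
have [w0|w0] := eqVneq (lnormi rho i x w) 0.
  by rewrite w0 mulr0 (lnormi_eq0 w0) -(rmorph0 (real_complex R)) normc_real normr0.
have w_gt0 : 0 < lnormi rho i x w by rewrite lt_def w0 lnormi_ge0.
have := @le_nu i a ((lnormi rho i x w)^-1%:C *: w).
rewrite lnormiZ ?invr_ge0 ?lnormi_ge0// mulVf// lexx => /(_ isT).
rewrite nuE lee_fin pairingZ normcM normc_real ger0_norm ?invr_ge0 ?lnormi_ge0//.
by rewrite ler_pdivrMl// mulrC.
Qed.

Lemma mu_ge0 : (0 <= mu rho f x)%E.
Proof.
rewrite /mu D_unit; apply: ereal_sup_ubound; exists 0.
  by rewrite /= -(scale0r 0) -(rmorph0 (real_complex R)) norm2Z// mul0r.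
by rewrite mulmx0 lnormE// wnorm_linform0.
Qed.

(** Applying the bounds to [b], of positive norm, shows that a finite [mu] is at least 1 because
    [Phi (z(b)) = b], and that a finite [nu] is positive because otherwise [z(b) = 0]. So an
    infinite [mu] or [nu] would make the product infinite. *)
Lemma invariants_finite (n_gt0 : (0 < n)%N) (alpha : R) :
  0 < N (- synth (fun=> 1)) ->
  ((2^-1)%:E * beta rho f x * mu rho f x * nu rho x <= alpha%:E)%E ->
  exists M V : R, [/\ mu rho f x = M%:E, nu rho x = V%:E, 1 <= M, 0 < V &
    N (- synth (fun=> 1)) * M * V <= 2 * alpha].
Proof.
rewrite betaE; set b := - synth _ => b_gt0 le_alpha.
have nu0 : (0 <= nu rho x)%E.
  have [a0 a0A] := fset0Pn _ (A_neq0 (Ordinal n_gt0)).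
  apply: le_trans (@le_nu _ [` a0A]%fset 0 _); first by rewrite lee_fin normc_ge0.
  by rewrite -(scale0r (0 : Cn)) -(rmorph0 (real_complex R)) lnormiZ// mul0r.
have b2 : 0 < 2^-1 * N b by rewrite mulr_gt0// invr_gt0.
have mu_fin (M : R) : mu rho f x = M%:E -> 1 <= M.
  by move=> /mu_bound/(_ (linform l b)); rewrite local_synthK -[leLHS]mul1r ler_pM2r.
have nu_fin (V : R) : nu rho x = V%:E -> 0 < V.
  move=> nuE; rewrite lt_def -lee_fin -nuE nu0 andbT; apply/eqP => V0.
  suff /eqP : N b = 0 by rewrite gt_eqF.
  rewrite /wnorm big1 ?sqrtr0// => j _.
  have := nu_bound nuE b j; rewrite V0 mul0r => le0.
  by rewrite cabs2E [normc _](_ : _ = 0) ?expr0n ?mulr0//; apply/eqP; rewrite eq_le le0 normc_ge0.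
have := mu_ge0; move: le_alpha nu0 mu_fin nu_fin; rewrite -EFinM.
case: (mu rho f x) => [M| |] //; case: (nu rho x) => [V| |] //.
- rewrite -!EFinM !lee_fin => le_alpha _ mu_fin nu_fin _; exists M, V.
  by split => //; [exact: mu_fin|exact: nu_fin|lra].
- move=> + _ mu_fin _ _; rewrite -EFinM gt0_muley ?lte_fin//.
  by rewrite mulr_gt0// (lt_le_trans ltr01)// mu_fin.
- move=> + _ _ nu_fin _; rewrite gt0_muley ?lte_fin// gt0_mulye ?lte_fin//.
  exact: nu_fin.
- by move=> + _ _ _ _; rewrite gt0_muley ?gt0_muley ?lte_fin.
Qed.

End LocalInvariants.

(** * Change of base point and the distance on the quotient *)

Section QuotientDistance.
Variables (R : realType) (n : nat) (A : 'I_n -> {fset 'rV[R]_n}).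
Hypothesis A_neq0 : forall i, A i != fset0.
Variable rho : forall i, A i -> R.
Hypothesis rho_gt0 : forall i (a : A i), 0 < rho a.
Local Notation C := R[i].
Local Notation Cn := 'cV[C]_n.
Implicit Types (x y z u v w : Cn).
Local Notation J := (local_index A).
Local Notation N x w := (wnorm (local_weight rho x) (linform (local_row rho x) w)).

Lemma Re_sumc (I : finType) (F : I -> C) :
  complex.Re (\sum_k F k) = \sum_k complex.Re (F k).
Proof. by elim/big_rec2 : _ => // k y1 y2 _ <-; rewrite Re_addc. Qed.

(** All terms of [kerK] pick up the same factor [e^(2 Re m u)], which cancels in the quotient and
    leaves the centred exponents: the weights are tilted exponentially and renormalised. *)
Lemma weight_shift i x u (a : A i) :
  weight rho (x + u) a =
  weight rho x a * expR (2 * complex.Re (pairing (val a - momentum rho i x) u)) /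
  \sum_(c : A i) weight rho x c *
    expR (2 * complex.Re (pairing (val c - momentum rho i x) u)).
Proof.
pose m := momentum rho i x.
pose E (c : A i) := expR (2 * complex.Re (pairing (val c - m) u)).
have E1 (c : A i) : rho c ^+ 2 * expR (2 * complex.Re (pairing (val c) (x + u))) =
    kerK rho i x * expR (2 * complex.Re (pairing m u)) * (weight rho x c * E c).
  rewrite /weight -/m /E pairingBl Re_addc Re_oppc pairingD Re_addc mulrDr expRD.
  have -> : expR (2 * complex.Re (pairing (val c) u)) =
      expR (2 * complex.Re (pairing m u)) *
      expR (2 * (complex.Re (pairing (val c) u) - complex.Re (pairing m u))).
    by rewrite -expRD; congr expR; ring.
  by field; rewrite gt_eqF// kerK_gt0.
have K_E : kerK rho i (x + u) = kerK rho i x * expR (2 * complex.Re (pairing m u)) *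
    \sum_(c : A i) weight rho x c * E c.
  by rewrite /kerK mulr_sumr; apply: eq_bigr => c _; rewrite E1.
have cancel (a' b c : R) : a' != 0 -> a' * b / (a' * c) = b / c.
  by move=> a0; rewrite -mulf_div divff// mul1r.
rewrite {1}/weight E1 K_E; apply: cancel.
by rewrite gt_eqF// mulr_gt0 ?expR_gt0// kerK_gt0.
Qed.

(* Jensen's inequality for the centered variable [Re ((a - m) u)]. *)
Lemma weight_shift_le i x u (a : A i) : weight rho (x + u) a <=
  weight rho x a * expR (2 * complex.Re (pairing (val a - momentum rho i x) u)).
Proof.
rewrite weight_shift ler_pdivrMr; last first.
  have [a0 a0A] := fset0Pn _ (A_neq0 i).
  rewrite (bigD1 [` a0A]%fset)//= ltr_wpDr//; last first.
    by rewrite mulr_gt0 ?weight_gt0 ?expR_gt0.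
  by apply: sumr_ge0 => c _; rewrite mulr_ge0 ?expR_ge0// ltW// weight_gt0.
apply: ler_peMr.
  by rewrite mulr_ge0 ?expR_ge0// ltW// weight_gt0.
apply: (@le_trans _ _ (\sum_(c : A i) weight rho x c *
    (1 + 2 * complex.Re (pairing (val c - momentum rho i x) u)))).
  under eq_bigr do rewrite mulrDr mulr1.
  rewrite big_split /= weight_sum// lerDl.
  have sum0 : \sum_(c : A i) weight rho x c *
      complex.Re (pairing (val c - momentum rho i x) u) = 0.
    rewrite -[RHS]/(complex.Re (0 : C)) -(weight_centered A_neq0 rho_gt0 i x u).
    by rewrite Re_sumc; apply: eq_bigr => c _; rewrite Re_mulc /= mul0r subr0.
  under eq_bigr do rewrite mulrCA.
  by rewrite -mulr_sumr sum0 mulr0.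
apply: ler_sum => c _; rewrite ler_wpM2l ?expR_ge1Dx// ltW// weight_gt0//.
Qed.

(* The variance is the least second moment. *)
Lemma lnormi_shift_le i x u w : lnormi rho i (x + u) w ^+ 2 <=
  \sum_(a : A i) weight rho x a *
    (expR (2 * complex.Re (pairing (val a - momentum rho i x) u)) *
     cabs2 (pairing (val a - momentum rho i x) w)).
Proof.
set m := momentum rho i x; set y := x + u; set m' := momentum rho i y.
apply: (@le_trans _ _ (\sum_(a : A i) weight rho y a * cabs2 (pairing (val a - m) w))).
  rewrite (lnormi2 A_neq0 rho_gt0); pose d := pairing (m' - m) w.
  have yd (a : A i) : pairing (val a - m) w = pairing (val a - m') w + d.
    by rewrite /d !pairingBl addrA subrK.
  under [leRHS]eq_bigr do rewrite yd.
  have cabs2D (z z' : C) : cabs2 (z + z') = cabs2 z + cabs2 z' +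
      2 * complex.Re (z * z'^*).
    by case: z z' => z1 z2 [z3 z4]; rewrite /cabs2 /=; ring.
  under [leRHS]eq_bigr do rewrite cabs2D mulrDr.
  rewrite big_split /=.
  have -> : \sum_(a : A i) weight rho y a * (2 * complex.Re (pairing (val a - m') w * d^*)) = 0.
    transitivity (2 * complex.Re ((\sum_(a : A i) (weight rho y a)%:C *
        pairing (val a - m') w) * d^*)).
      rewrite mulr_suml Re_sumc mulr_sumr; apply: eq_bigr => a _.
      by rewrite -[in RHS]mulrA [in RHS]Re_mulc [complex.Im _%:C]/= mul0r subr0 mulrCA.
    by rewrite weight_centered// mul0r mulr0.
  rewrite addr0; apply: ler_sum => a _; rewrite ler_wpM2l ?lerDl ?cabs2_ge0//.
  exact/ltW/weight_gt0.
apply: ler_sum => a _; rewrite mulrA ler_wpM2r ?cabs2_ge0//.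
exact: weight_shift_le.
Qed.

Lemma lnorm_shift_le x u w : lnorm rho (x + u) w ^+ 2 <=
  \sum_j local_weight rho x j *
    (expR (2 * complex.Re (linform (local_row rho x) u j)) *
     cabs2 (linform (local_row rho x) w j)).
Proof.
rewrite /lnorm sqr_sqrtr; last by apply: sumr_ge0 => i _; exact: sqr_ge0.
apply: (@le_trans _ _ (\sum_i \sum_(a : A i) weight rho x a *
    (expR (2 * complex.Re (pairing (val a - momentum rho i x) u)) *
     cabs2 (pairing (val a - momentum rho i x) w)))).
  by apply: ler_sum => i _; exact: lnormi_shift_le.
rewrite (@sig_big_dep _ _ _ _ _ xpredT (fun _ => xpredT) (fun i (a : A i) =>
  weight rho x a *
    (expR (2 * complex.Re (pairing (val a - momentum rho i x) u)) *
     cabs2 (pairing (val a - momentum rho i x) w)))).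
by apply: ler_sum => -[i a] _.
Qed.

Lemma lnorm_shift_expR_le x u w (t : R) :
  (forall j, normc (linform (local_row rho x) u j) <= t) ->
  lnorm rho (x + u) w <= expR t * N x w.
Proof.
move=> ut; rewrite -(@ler_pXn2r _ 2) ?nnegrE ?sqrtr_ge0//; last first.
  by rewrite mulr_ge0 ?expR_ge0 ?wnorm_ge0.
apply: (le_trans (lnorm_shift_le _ _ _)).
rewrite exprMn wnorm2; last by move=> j; exact: local_weight_ge0.
rewrite mulr_sumr; apply: ler_sum => j _; rewrite [leRHS]mulrCA.
apply: ler_wpM2l; first exact: local_weight_ge0.
apply: ler_wpM2r; first exact: cabs2_ge0.
rewrite -expRM_natr ler_expR mulrC; apply: ler_wpM2r => //.
exact: le_trans (ler_norm _) (le_trans (normr_Re _) (ut j)).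
Qed.

Lemma ldist_ge0 x y z : 0 <= ldist rho x y z.
Proof.
apply: lb_le_inf.
  exists (lnorm rho x (y - z)); exists y, z; split => //; exact: projeq_refl.
by move=> _ [y' [z' [_ _ ->]]]; exact: sqrtr_ge0.
Qed.

Lemma ldist_le x y z : ldist rho x y z <= lnorm rho x (y - z).
Proof.
apply: ge_inf.
  by exists 0 => _ [y' [z' [_ _ ->]]]; exact: sqrtr_ge0.
by exists y, z; split => //; exact: projeq_refl.
Qed.

Lemma ldistxx x y : ldist rho x y y = 0.
Proof.
apply/eqP; rewrite eq_le ldist_ge0 andbT (le_trans (ldist_le _ _ _))//.
by rewrite subrr lnormE// wnorm_linform0.
Qed.

Lemma evalV_neq0 i x (a : A i) : evalV rho x a != 0.
Proof.
rewrite mulf_neq0 ?cexp_neq0//.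
by rewrite -(rmorph0 (real_complex R)) (inj_eq (@complexI R)) gt_eqF.
Qed.

(** The ratio given by [projeq] depends on the equation but not on the exponent, so it cancels in
    differences of exponents. *)
Lemma projeq_period y' y i (a c : A i) : projeq rho y' y ->
  cexp (pairing (val a - val c) (y' - y)) = 1.
Proof.
move=> yy; have [k k0 kE] := yy i.
have expE (b : A i) : cexp (pairing (val b) (y' - y)) = k.
  apply: (mulfI (evalV_neq0 y b)); rewrite [RHS]mulrC -kE /evalV -mulrA -cexpD.
  by rewrite -pairingD addrC subrK.
rewrite pairingBl cexpD expE.
apply: (mulfI k0); rewrite mulr1 -{1}(expE c) mulrCA -cexpD.
by rewrite subrr cexp0 mulr1.
Qed.

(* Two representatives differ by a period [w] with [cexp ((a - c) w) = 1]: either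
   all [(a - c) w] vanish, or one of them has modulus at least 2 and then [w] has
   norm at least [1 / V], so the shortest representatives are the given ones. *)
Lemma le_ldist x b (V : R) : 0 <= V ->
  (forall w j, normc (linform (local_row rho x) w j) <= V * N x w) ->
  2 * V * N x b <= 1 -> N x b <= ldist rho x (x + b) x.
Proof.
move=> V0 lin_bound Vb; apply: lb_le_inf.
  by exists (lnorm rho x (x + b - x)), (x + b), x; split => //; exact: projeq_refl.
move=> _ [y [z [yx zx ->]]]; rewrite lnormE//.
set w := (y - (x + b)) - (z - x).
have -> : y - z = b + w.
  by apply/colP => i; rewrite /w !mxE; ring.
have per i (a c : A i) : cexp (pairing (val a - val c) w) = 1.
  have := projeq_period a c yx; rewrite -(subrK (z - x) (y - (x + b))) -/w.
  by rewrite pairingD cexpD (projeq_period a c zx) mulr1.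
have [[i [a [c ac]]]|no_period] := pselect (exists i, exists a c : A i,
    2 <= normc (pairing (val a - val c) w)).
  have Vw : 1 <= V * N x w.
    have := lin_bound w (Tagged (fun i => A i) a).
    have := lin_bound w (Tagged (fun i => A i) c).
    have : normc (pairing (val a - val c) w) <=
        normc (pairing (val a - momentum rho i x) w) +
        normc (pairing (val c - momentum rho i x) w).
      have -> : pairing (val a - val c) w =
          pairing (val a - momentum rho i x) w - pairing (val c - momentum rho i x) w.
        by rewrite !pairingBl; ring.
      by apply: le_trans (le_normcD _ _) _; rewrite normcN.
    rewrite /linform /local_row [tagged _]/= [tag _]/= /pairing.
    move: ac; rewrite /pairing; lra.
  have V_gt0 : 0 < V.
    rewrite lt_def V0 andbT; apply/eqP => VE.
    by move: Vw; rewrite VE mul0r ler10.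
  have wb : 2 * N x b <= N x w.
    by rewrite -(ler_pM2l V_gt0) mulrCA mulrA; exact: le_trans Vb Vw.
  have bw : N x ((b + w) - b) <= N x (b + w) + N x b.
    by apply: wnorm_linformB => j; exact: local_weight_ge0.
  rewrite addrAC subrr add0r in bw.
  move: bw wb; move: (N x b) (N x w) (N x (b + w)) => r1 r2 r3; lra.
suff w0 j : linform (local_row rho x) w j = 0.
  rewrite (@eq_wnorm _ _ _ (linform (local_row rho x) (b + w)) (linform (local_row rho x) b))//.
  by move=> j; rewrite linformD w0 addr0.
case: j => i a; rewrite /linform /local_row [tagged _]/= [tag _]/=.
rewrite -/(pairing (val a - momentum rho i x) w).
(* [z_a(w)] is written as an average over [c], and 0 as the average of the [z_c(w)]; the two sums
   agree termwise as [(a - c) w = 0]. *)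
rewrite -[LHS]mul1r -(rmorph1 (real_complex R)) -(weight_sum A_neq0 rho_gt0 i x).
rewrite rmorph_sum mulr_suml -[RHS](weight_centered A_neq0 rho_gt0 i x w).
apply: eq_bigr => c _; congr (_ * _).
have ac0 : pairing (val a - val c) w = 0.
  have [//|ac2] := cexp_eq1 (per i a c).
  by case: no_period; exists i, a, c.
by apply/eqP; rewrite -subr_eq0 -ac0 !pairingBl; apply/eqP; ring.
Qed.

End QuotientDistance.

(** * Injective square matrices and convergence of columns *)

Section Convergence.
Variables (R : realType) (n : nat).
Local Notation C := R[i].
Local Notation Cn := 'cV[C]_n.

Lemma unitmx_inj (M : 'M[C]_n) : (forall w : Cn, M *m w = 0 -> w = 0) ->
  M \in unitmx.
Proof.
move=> injM; rewrite -unitmx_tr -row_free_unit -kermx_eq0.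
apply/rowV0P => v /sub_kermxP vM.
have : M *m v^T = 0 by rewrite -[M]trmxK -trmx_mul vM trmx0.
by move=> /injM /(congr1 trmx); rewrite trmxK trmx0.
Qed.

Lemma cvg_geometric_col (x : nat -> Cn) (z : Cn) (K : R) :
  (forall k i, normc ((x k - z) i 0) <= K * 2^-1 ^+ k) -> x k @[k --> \oo] --> z.
Proof.
move=> xK; apply/cvgrPdist_le => eps eps0.
have epsE : eps = (complex.Re eps)%:C by rewrite RRe_real// gtr0_real.
have e0 : 0 < complex.Re eps by move: eps0; rewrite epsE ltcR.
have K_cvg : K * 2^-1 ^+ k @[k --> \oo] --> K * 0.
  apply: cvgMl_tmp; apply: cvg_expr.
  by rewrite ger0_norm ?invr_ge0// invf_lt1// ltr1n.
rewrite mulr0 in K_cvg.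
have /cvgrPdist_lt/(_ _ e0) := K_cvg.
apply: filterS => k; rewrite sub0r normrN => Kk.
apply: norm_le_coord => [|i]; first exact: ltW.
rewrite normcEC epsE lecR -normcN.
have -> : - (z - x k) i 0 = (x k - z) i 0 by rewrite !mxE opprB.
exact: le_trans (xK k i) (le_trans (ler_norm _) (ltW Kk)).
Qed.

End Convergence.

(** * The Newton iteration in preconditioned coordinates *)

Section NewtonSequence.
Variables (R : realType) (n : nat) (A : 'I_n -> {fset 'rV[R]_n}).
Hypothesis A_neq0 : forall i, A i != fset0.
Variable rho : forall i, A i -> R.
Hypothesis rho_gt0 : forall i (a : A i), 0 < rho a.
Local Notation C := R[i].
Local Notation Cn := 'cV[C]_n.
Variables (f : system A) (x0 : Cn).
Hypothesis D_unit : newtDS rho f x0 0 \in unitmx.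
Local Notation p := (local_weight rho x0).
Local Notation l := (local_row rho x0).
Local Notation N w := (wnorm p (linform l w)).
Local Notation synth := (synthesis (local_synth rho f x0)).
Local Notation b := (- synth (fun=> 1)).
Local Notation x := (newton_seq rho f x0).

Lemma is_zero_newtS u : newtS rho f x0 u = 0 -> is_zero rho f (x0 + u).
Proof.
move=> S0 i; have /colP/(_ i) := S0; rewrite !mxE => /eqP.
have W0 : (normW rho i x0)^-1%:C != 0 :> C.
  rewrite -(rmorph0 (real_complex R)) (inj_eq (@complexI R)).
  by rewrite invr_eq0 gt_eqF// normW_gt0.
rewrite mulf_eq0 (negbTE W0) /= => /eqP S0i.
apply: (mulfI (cexp_neq0 (- pairing (momentum rho i x0) (x0 + u)))).
rewrite mulr0 -[RHS]S0i mulr_sumr; apply: eq_bigr => a _.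
by rewrite /evalW mulrCA.
Qed.

Lemma synth_newtS u : synth (expform l u) = invmx (newtDS rho f x0 0) *m newtS rho f x0 u.
Proof. by rewrite local_synthE newtSE. Qed.

Lemma newtS_eq0 u : synth (expform l u) = 0 -> newtS rho f x0 u = 0.
Proof.
by rewrite synth_newtS => /(congr1 (mulmx (newtDS rho f x0 0))); rewrite mulKVmx// mulmx0.
Qed.

Lemma synth_newtDS u w : synth (fun j => expform l u j * linform l w j) =
  invmx (newtDS rho f x0 0) *m (newtDS rho f x0 u *m w).
Proof.
rewrite local_synthE; congr (_ *m _).
by rewrite newtDSE// newt_jacobianM.
Qed.

Lemma newtDS_unit u :
  (forall w, synth (fun j => expform l u j * linform l w j) = 0 -> w = 0) ->
  newtDS rho f x0 u \in unitmx.
Proof.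
move=> inj; apply: unitmx_inj => w Dw; apply: inj.
by rewrite synth_newtDS Dw mulmx0.
Qed.

Lemma newton_seqS k : x k.+1 - x0 = newton rho f x0 (x k - x0).
Proof. by rewrite /= addrC addKr. Qed.

(** Puts the step, defined through [invmx], into the form of the linear equation assumed by
    [newton_error]. *)
Lemma synth_newton u : newtDS rho f x0 u \in unitmx ->
  synth (fun j => expform l u j * linform l (newton rho f x0 u - u) j) =
  - synth (expform l u).
Proof.
move=> Du; rewrite synth_newtDS synth_newtS /newton addrAC subrr add0r.
by rewrite mulmxN mulKVmx// mulmxN.
Qed.

Lemma synth_one : synth (fun=> 1) = invmx (newtDS rho f x0 0) *m newtS rho f x0 0.
Proof. by rewrite local_synthE newtS_at0. Qed.

Lemma newton0 : newton rho f x0 0 = b.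
Proof. by rewrite /newton sub0r synth_one. Qed.

End NewtonSequence.

(** * Alpha theory *)

Section NewtonRate.
Variable R : realType.
Implicit Types e r s : R.

(** The factor [2^(1 - 2^k)] of (a) and (b); it obeys the recursion [r' = r^2 / 2] from the value 1
    at index 0. *)
Definition newton_rate (k : nat) : R := 2 / 2 ^+ (2 ^ k)%N.

Lemma newton_rate1 : newton_rate 1 = 1/2.
Proof. by rewrite /newton_rate expn1; field. Qed.

Lemma newton_rateS k : newton_rate k.+1 = newton_rate k ^+ 2 / 2.
Proof.
rewrite /newton_rate expnS mulnC exprM; have : 2 ^+ (2 ^ k)%N != 0 :> R.
  by rewrite expf_neq0.
by move: (2 ^+ (2 ^ k)%N) => y y0; field.
Qed.

Lemma newton_rate_bounds k : 0 < newton_rate k.+1 <= 2^-1 ^+ k.+1.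
Proof.
elim: k => [|k /andP[r0 r1]].
  by rewrite /newton_rate expn1 expr1; lra.
rewrite newton_rateS divr_gt0 ?exprn_gt0//= (exprSr _ k.+1).
apply: ler_wpM2r; first by rewrite invr_ge0.
apply: (le_trans _ r1); rewrite expr2 ler_piMl ?(ltW r0)//.
apply: (@le_trans _ _ (2^-1 ^+ k.+1)) => //.
by rewrite exprn_ile1 ?invr_ge0// invf_le1// ler1n.
Qed.

Lemma newton_rate_le k : newton_rate k.+1 <= 1/2.
Proof.
have /andP[_ r1] := newton_rate_bounds k; apply: (le_trans r1).
rewrite exprS div1r ler_piMr ?invr_ge0// exprn_ile1 ?invr_ge0//.
by rewrite invf_le1// ler1n.
Qed.

Lemma geometric_rate_le k : 16/25 * newton_rate k.+1 <= 2^-1 ^+ k.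
Proof.
have /andP[r0 r1] := newton_rate_bounds k.
have q0 : 0 <= 2^-1 ^+ k :> R by rewrite exprn_ge0// invr_ge0.
by move: r1; rewrite exprS => r1; lra.
Qed.

Lemma newton_rate_gt0 k : 0 < newton_rate k.
Proof. by rewrite divr_gt0// exprn_gt0. Qed.

(** The constants close up because [3/4 (16/25)^2 = 192/625] is at most [(16/25) / 2 = 200/625]. *)
Lemma contraction_rate (N e e' r : R) : 0 < N -> 0 <= e -> 0 < r ->
  e <= 16/25 * r * N -> e' * N <= 3/4 * e ^+ 2 -> e' <= 16/25 * (r ^+ 2 / 2) * N.
Proof.
move=> N_gt0 e0 r0 er e'e; rewrite -(ler_pM2r N_gt0); apply: (le_trans e'e).
have e2 : e ^+ 2 <= (16/25 * r * N) ^+ 2.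
  by rewrite lerXn2r ?nnegrE// (le_trans e0).
have rN : 0 <= r ^+ 2 * N ^+ 2 by rewrite mulr_ge0 ?sqr_ge0.
lra.
Qed.

Lemma half_rate_le r : r <= 1/2 -> 16/25 * r <= 8/25.
Proof. lra. Qed.

Lemma next_rate_le r : 0 < r -> r <= 1/2 -> 16/25 * (r ^+ 2 / 2) <= 10^-1.
Proof. nra. Qed.

Lemma first_rate_le s : s <= 8/25 -> s <= 16/25 * newton_rate 1.
Proof. by rewrite newton_rate1; lra. Qed.

Lemma lt3_of_radius e r s : e <= 8/25 * r -> r <= s -> s <= 5/12 -> e < 3.
Proof. lra. Qed.

Lemma le1_of_radius r s : r <= s -> s <= 5/12 -> 2 * r <= 1.
Proof. lra. Qed.

Lemma radius_le_nine_twentieths s : s <= 5/12 -> s <= 9/20.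
Proof. lra. Qed.

Lemma rate_distortion e r s : 0 <= s -> 0 <= r -> e <= 25/16 -> e * (16/25 * r * s) <= r * s.
Proof.
move=> s0 r0 e1; have rs : 0 <= r * s by rewrite mulr_ge0.
have -> : e * (16/25 * r * s) = (e * (16/25)) * (r * s) by ring.
by apply: ler_piMl => //; lra.
Qed.

End NewtonRate.

Section AlphaTheory.
Local Opaque wnorm linform synthesis expform local_row local_weight local_synth newton newtDS.
Variables (R : realType) (n : nat) (A : 'I_n -> {fset 'rV[R]_n}).
Hypothesis A_neq0 : forall i, A i != fset0.
Variable rho : forall i, A i -> R.
Hypothesis rho_gt0 : forall i (a : A i), 0 < rho a.
Local Notation C := R[i].
Local Notation Cn := 'cV[C]_n.
Variables (f : system A) (x0 : Cn).
Hypothesis D_unit : newtDS rho f x0 0 \in unitmx.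
Local Notation p := (local_weight rho x0).
Local Notation l := (local_row rho x0).
Local Notation N w := (wnorm p (linform l w)).
Local Notation synth := (synthesis (local_synth rho f x0)).
Local Notation b := (- synth (fun=> 1)).
Local Notation x := (newton_seq rho f x0).

Variables (M V alpha : R).
Hypothesis synth_bound : forall y, N (synth y) <= M * wnorm p y.
Hypothesis lin_bound : forall w j, normc (linform l w j) <= V * N w.
Hypothesis alpha_gt0 : 0 < alpha.
Hypothesis alpha_le : alpha <= (13 - 3 * Num.sqrt 17) / 4.
Hypothesis M1 : 1 <= M.
Hypothesis V_gt0 : 0 < V.
Hypothesis b_gt0 : 0 < N b.
Hypothesis bMV : N b * M * V <= 2 * alpha.

Local Notation T := (alpha_radius alpha).
Local Notation theta := (alpha_ratio alpha).
Local Notation h := (theta * N b).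
Let p_ge0 : forall j, 0 <= p j :=
  local_weight_ge0 A_neq0 rho_gt0 x0.
Let synthK := local_synthK D_unit.
Let M_ge0 : 0 <= M := le_trans ler01 M1.
Let V_ge0 : 0 <= V := ltW V_gt0.
Let theta_ge0 : 0 <= theta :=
  le_trans ler01 (alpha_ratio_bounds alpha_gt0 alpha_le).1.
Let h_ge0 : 0 <= h := mulr_ge0 theta_ge0 (ltW b_gt0).
Let Vh_ge0 : 0 <= V * h := mulr_ge0 V_ge0 h_ge0.
Let T_gt0 := alpha_radius_gt0 alpha_gt0 alpha_le.
Let T_le := alpha_radius_le alpha_gt0 alpha_le.

Let T3 : T < 3.
Proof. by have := T_le; lra. Qed.

Lemma radius_le : M * (V * h) <= T.
Proof.
rewrite -(alpha_ratio_radius alpha_gt0 alpha_le).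
have -> : M * (V * h) = N b * M * V * theta by ring.
exact: ler_wpM2r.
Qed.

Lemma Vh_le : V * h <= T.
Proof. by apply: le_trans radius_le; rewrite ler_peMl. Qed.

Let Vh3 : V * h < 3 := le_lt_trans Vh_le T3.

Let M_pade : M * pade_rate (V * h) <= pade_rate T :=
  mul_pade_rate_le M1 Vh_ge0 radius_le T3.

Lemma pade_h : M * (pade_rate (V * h) * h) <= (theta - 1) * N b.
Proof.
rewrite mulrA; apply: (@le_trans _ _ (pade_rate T * h)); first exact: ler_wpM2r.
by rewrite mulrA pade_rate_radius.
Qed.

Lemma root_in_ball : exists2 u, synth (expform l u) = 0 & N u <= h.
Proof.
apply: (exists_root p_ge0 synthK synth_bound lin_bound M_ge0 V_ge0
  (q := T * (1 + pade_rate T))) => //.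
- rewrite -lerBrDl; apply: (le_trans pade_h).
  by rewrite mulrBl mul1r.
- exact: mul_expR_sub1_le M1 Vh_ge0 radius_le T3.
- have := pade_rate_radius_le alpha_gt0 alpha_le; have := T_le; have := T_gt0.
  nra.
Qed.

Variable u : Cn.
Hypothesis u_root : synth (expform l u) = 0.
Hypothesis u_le : N u <= h.
Let Vu_le : V * N u <= V * h := ler_wpM2l V_ge0 u_le.

(** At a root the simplified Newton identity reads [b - u = Phi (e^z(u) - 1 - z(u))], so the first
    error is itself a remainder on the ball of radius [h]. *)
Lemma first_error : N (b - u) <= (theta - 1) * N b.
Proof.
have E : b - u = synth (fun j => expform l u j - 1 - linform l u j).
  have := simplified_newtonE synthK u; rewrite u_root subr0 => {1}->.
  by rewrite opprB addrC subrK.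
rewrite E; apply: (le_trans (synth_bound _)).
apply: le_trans pade_h; apply: ler_wpM2l => //.
apply: (le_trans (wnorm_rem p_ge0 lin_bound V_ge0 Vu_le Vh3)).
apply: ler_wpM2l => //; apply: pade_rate_ge0; exact/andP.
Qed.

Lemma Vb_le : V * N b <= T.
Proof.
apply: le_trans Vh_le; apply: ler_wpM2l => //.
by rewrite ler_peMl ?(ltW b_gt0)//; have [] := alpha_ratio_bounds alpha_gt0 alpha_le.
Qed.

Local Notation newton_rate := (newton_rate R).
Local Notation y k := (x k - x0).
Local Notation t := (V * (h + N b / 10)).

Let t_ge0 : 0 <= t.
Proof. by apply: mulr_ge0 => //; apply: addr_ge0 => //; rewrite divr_ge0// ltW. Qed.

Let t_le : M * t <= T + alpha / 5.
Proof.
have -> : M * t = M * (V * h) + N b * M * V / 10 by ring.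
apply: lerD; first exact: radius_le.
by move: bMV; lra.
Qed.

Lemma expR_t_lt : M * (expR t - 1) < 1.
Proof.
have tle : M * t <= 9/20 := le_trans t_le (newton_radius_le alpha_gt0 alpha_le).
apply: (le_lt_trans (mul_expR_sub1_le M1 t_ge0 tle _)); first lra.
by rewrite /pade_rate mulrDr mulr1 mulrA -ltrBrDl ltr_pdivrMr; lra.
Qed.

(** The margin [N b / 10] beyond [h] leaves room for iterates farther out than the ball of the root;
    through [beta mu nu <= 2 alpha] it costs [alpha / 5] in [t_le]. *)
Lemma derivative_unit w : N w <= h + N b / 10 -> newtDS rho f x0 w \in unitmx.
Proof.
move=> wh; apply: newtDS_unit => // v.
apply: (newton_derivative_inj p_ge0 synthK synth_bound lin_bound M_ge0 V_ge0
  (t := t)); last exact: expR_t_lt.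
exact: ler_wpM2l.
Qed.

(* The factor 16/25 absorbs the change of metric, which costs [e^T <= 25/16]. *)
Lemma newton_invariant k : N (y k) <= h + N b / 10 /\
  ((0 < k)%N -> N (y k - u) <= 16/25 * newton_rate k * N b).
Proof.
have b10 : 0 <= N b / 10 by rewrite divr_ge0// ltW.
elim: k => [|k [yk ek]].
  by split=> //; rewrite /= subrr wnorm_linform0 addr_ge0.
have Dk := derivative_unit yk.
have yE : y k.+1 = newton rho f x0 (y k) := newton_seqS _ _ _ _.
have [k0|k_gt0] := posnP k.
  have y1 : y k.+1 = b.
    by rewrite yE k0 /= subrr newton0.
  rewrite y1; split.
    have [th1 _] := alpha_ratio_bounds alpha_gt0 alpha_le.
    rewrite -[leLHS]addr0; apply: lerD => //.
    by rewrite ler_peMl// ltW.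
  move=> _; apply: (le_trans first_error); rewrite k0.
  have [_ th2] := alpha_ratio_bounds alpha_gt0 alpha_le.
  by apply: ler_wpM2r; [exact: ltW|exact: first_rate_le].
have {}ek := ek k_gt0.
have r_le : newton_rate k <= 1/2 by rewrite -(prednK k_gt0) newton_rate_le.
have r_gt0 := newton_rate_gt0 R k.
have e_le : N (y k - u) <= 8/25 * N b.
  by apply: (le_trans ek); apply: ler_wpM2r; [exact: ltW|exact: half_rate_le].
have Ve3 : V * N (y k - u) < 3.
  have Ve : V * N (y k - u) <= 8/25 * (V * N b).
    by rewrite [leRHS]mulrCA; exact: ler_wpM2l.
  exact: lt3_of_radius Ve Vb_le T_le.
have step := newton_error p_ge0 synthK synth_bound lin_bound M_ge0 V_ge0
  (y := y k) (y' := y k.+1) (u := u) (t := t) (ler_wpM2l V_ge0 yk) u_root Ve3.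
have {}step := step (etrans (congr1 (fun w => synth (fun j => expform l (y k) j *
  linform l (w - y k) j)) yE) (synth_newton Dk)).
have contr := newton_contraction alpha_gt0 alpha_le M1 V_ge0 b_gt0 bMV t_ge0 t_le
  (wnorm_ge0 _ _) e_le step.
have e_next : N (y k.+1 - u) <= 16/25 * newton_rate k.+1 * N b.
  by rewrite newton_rateS; apply: contraction_rate b_gt0 (wnorm_ge0 _ _) r_gt0 ek contr.
split=> [|//].
(* From the second iterate on the error is at most [2/25] of [N b], within the margin [N b / 10]. *)
have -> : y k.+1 = u + (y k.+1 - u) by rewrite [RHS]addrC subrK.
apply: (le_trans (wnorm_linformD p_ge0 _ _ _)); apply: lerD => //.
apply: (le_trans e_next); rewrite mulrC; apply: ler_wpM2l; first exact: ltW.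
by rewrite newton_rateS; exact: next_rate_le.
Qed.

Lemma newton_seq_unit k : newtDS rho f x0 (y k) \in unitmx.
Proof. by apply: derivative_unit; case: (newton_invariant k). Qed.

Local Notation zeta := (x0 + u).

Lemma newton_seq_errorE k : x k - zeta = y k - u.
Proof. by rewrite opprD addrA. Qed.

Lemma newton_seq_cvg : x k @[k --> \oo] --> zeta.
Proof.
rewrite -cvg_shiftS.
pose K i := \sum_j normc (local_synth rho f x0 j i 0) * V.
have K0 i : 0 <= K i by apply: sumr_ge0 => j _; rewrite mulr_ge0 ?normc_ge0.
apply: (@cvg_geometric_col _ _ _ _ (\sum_i K i * N b)) => k i.
rewrite newton_seq_errorE; apply: (le_trans (coord_le_wnorm_linform synthK lin_bound _ _)).
rewrite -mulr_suml -/(K i).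
have [_ /(_ isT) ek] := newton_invariant k.+1.
apply: (@le_trans _ _ (K i * N b * 2^-1 ^+ k)).
  rewrite -mulrA; apply: ler_wpM2l => //; apply: (le_trans ek).
  rewrite mulrC; apply: ler_wpM2l; first exact: ltW.
  exact: (geometric_rate_le R k).
apply: ler_wpM2r; first by rewrite exprn_ge0// invr_ge0.
rewrite (bigD1 i)//= lerDl; apply: sumr_ge0 => j _.
by rewrite mulr_ge0// ltW.
Qed.

Lemma toric_seq_cvg : (fun k => toric_pi rho (x k)) @ \oo --> toric_pi rho zeta.
Proof.
exact: (cvg_comp _ _ newton_seq_cvg (@pi_continuous _ _ zeta)).
Qed.

Let lin_u_le j : normc (linform l u j) <= T.
Proof. exact: (linform_le lin_bound j (le_trans Vu_le Vh_le)). Qed.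

Lemma ldist_x0_le k : (0 < k)%N ->
  ldist rho x0 (x k) zeta <= newton_rate k * N b.
Proof.
move=> k0; apply: (le_trans (ldist_le _ _ _ _)); rewrite lnormE//.
have [_ /(_ k0) ek] := newton_invariant k.
rewrite newton_seq_errorE; apply: (le_trans ek).
rewrite -[leLHS]mul1r; apply: rate_distortion; [exact: ltW|exact: ltW (newton_rate_gt0 R k)|].
by rewrite lter_pdivlMr// mul1r ler_nat.
Qed.

Lemma ldist_zeta_le k : (0 < k)%N ->
  ldist rho zeta (x k) zeta <= newton_rate k * N b.
Proof.
move=> k0; apply: (le_trans (ldist_le _ _ _ _)).
rewrite newton_seq_errorE.
apply: (le_trans (lnorm_shift_expR_le A_neq0 rho_gt0 _ lin_u_le)).
have [_ /(_ k0) ek] := newton_invariant k.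
apply: (@le_trans _ _ (expR T * (16/25 * newton_rate k * N b))).
  by apply: ler_wpM2l ek; exact: expR_ge0.
apply: rate_distortion; [exact: ltW|exact: ltW (newton_rate_gt0 R k)|].
exact: expR_radius_le.
Qed.

(** The one place where the minimum over representatives must be bounded below:
    [2 V N b <= 2 T <= 5/6], so [le_ldist] applies. *)
Lemma ldist_first : ldist rho x0 (x 1%N) x0 = N b.
Proof.
have x1E : x 1%N = x0 + b by rewrite /= subrr newton0.
apply/eqP; rewrite eq_le; apply/andP; split.
  apply: (le_trans (ldist_le _ _ _ _)); rewrite lnormE// x1E.
  by rewrite addrAC subrr add0r.
rewrite x1E; apply: (le_ldist A_neq0 rho_gt0 V_ge0 lin_bound).
by rewrite -mulrA; exact: le1_of_radius Vb_le T_le.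
Qed.

Local Notation r0 := ((1 + alpha - Num.sqrt (1 - 6 * alpha + alpha ^+ 2)) / (4 * alpha)).
Local Notation r1 := ((1 - 3 * alpha - Num.sqrt (1 - 6 * alpha + alpha ^+ 2)) / (4 * alpha)).

Let distortion_ge1 : 1 <= metric_distortion alpha.
Proof.
rewrite /metric_distortion -addrA lerDl.
have T0 := ltW T_gt0.
by apply: addr_ge0; apply: mulr_ge0; rewrite ?exprn_ge0//; lra.
Qed.

(** As the distortion is at least 1, the inequality for (d) gives [theta - 1 <= r1], that is
    [theta <= r0]. *)
Lemma ldist_x0_zeta_le : ldist rho x0 x0 zeta <= r0 * N b.
Proof.
apply: (le_trans (ldist_le _ _ _ _)); rewrite lnormE//.
rewrite opprD addrA subrr add0r (wnorm_linformN p l u); apply: (le_trans u_le).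
apply: ler_wpM2r; first exact: ltW.
have [th1 _] := alpha_ratio_bounds alpha_gt0 alpha_le.
have [_ le_r] := distorted_ratio_le alpha_gt0 alpha_le.
rewrite r0E// -lerBlDl; apply: le_trans le_r.
rewrite ler_peMl ?subr_ge0//.
by rewrite -[leLHS]sqrtr1 ler_wsqrtr// distortion_ge1.
Qed.

Lemma ldist_zeta_first_le : ldist rho zeta (x 1%N) zeta <= r1 * N b.
Proof.
apply: (le_trans (ldist_le _ _ _ _)).
have -> : x 1%N - zeta = b - u.
  rewrite newton_seq_errorE; congr (_ - _).
  by rewrite /= subrr newton0 addrAC subrr add0r.
have A1 := distortion_ge1.
have A0 : 0 <= metric_distortion alpha := le_trans ler01 A1.
have P1 := pade_rate_radius_lt1 alpha_gt0 alpha_le.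
have refined := refined_error p_ge0 synthK synth_bound lin_bound M_ge0 V_ge0
  u_root Vu_le Vh3 A1 (le_lt_trans M_pade P1).
have {}refined := refined (fun j => expR2_le (lin_u_le j) _).
have [th1 _] := alpha_ratio_bounds alpha_gt0 alpha_le.
have [_ le_r] := distorted_ratio_le alpha_gt0 alpha_le.
apply: le_trans (ler_wpM2r (ltW b_gt0) le_r).
have ge0 : 0 <= Num.sqrt (metric_distortion alpha) * (theta - 1) * N b.
  by rewrite !mulr_ge0 ?sqrtr_ge0 ?subr_ge0// ltW.
rewrite -(@ler_pXn2r _ 2) ?nnegrE ?sqrtr_ge0//.
apply: (le_trans (lnorm_shift_le A_neq0 rho_gt0 _ _ _)).
apply: (le_trans (refined _)); first exact: radius_le_nine_twentieths T_le.
have -> : (Num.sqrt (metric_distortion alpha) * (theta - 1) * N b) ^+ 2 =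
    metric_distortion alpha * ((theta - 1) * N b) ^+ 2.
  by rewrite -mulrA exprMn sqr_sqrtr.
apply: ler_wpM2l => //.
have := M_pade; set k := M * pade_rate (V * h) => k_le.
have k0 : 0 <= k by rewrite mulr_ge0// pade_rate_ge0// Vh_ge0.
have k1 : k < 1 := le_lt_trans k_le P1.
have k_ge0 : 0 <= k * N b / (1 - k).
  by apply: divr_ge0; [exact: mulr_ge0 (ltW b_gt0)|rewrite subr_ge0 ltW].
(* [k / (1 - k)] increases with [k] and equals [theta - 1] at [k = pade_rate T]. *)
have k_rate : k * N b / (1 - k) <= (theta - 1) * N b.
  rewrite mulrAC; apply: ler_wpM2r; first exact: ltW.
  rewrite -(alpha_ratio_pade alpha_gt0 alpha_le).
  apply: ler_pM => //; first by rewrite invr_ge0 subr_ge0 ltW.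
  by rewrite lef_pV2 ?posrE ?subr_gt0// lerD2l lerN2.
by apply: lerXn2r => //; rewrite nnegrE (le_trans k_ge0 k_rate).
Qed.

End AlphaTheory.

(** * The case [beta = 0] *)

Section StationaryNewton.
Variables (R : realType) (n : nat) (A : 'I_n -> {fset 'rV[R]_n}).
Hypothesis A_neq0 : forall i, A i != fset0.
Variable rho : forall i, A i -> R.
Hypothesis rho_gt0 : forall i (a : A i), 0 < rho a.
Variables (f : system A) (x0 : 'cV[R[i]]_n).
Hypothesis D_unit : newtDS rho f x0 0 \in unitmx.
Local Notation synth := (synthesis (local_synth rho f x0)).
Local Notation b := (- synth (fun=> 1)).

(** With [beta = 0] the hypothesis does not bound [nu], so the forms are killed by the positivity of
    the weights rather than by [lin_bound]. *)
Lemma first_step_eq0 :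
  wnorm (local_weight rho x0) (linform (local_row rho x0) b) = 0 -> b = 0.
Proof.
rewrite -lnormE// => /eqP; rewrite sqrtr_eq0 => le0.
have ge0 (i : 'I_n) : true -> 0 <= lnormi rho i x0 b ^+ 2 by rewrite sqr_ge0.
have sum0 : \sum_i lnormi rho i x0 b ^+ 2 = 0.
  by apply/eqP; rewrite eq_le le0 sumr_ge0.
rewrite -(local_synthK D_unit b) /synthesis big1// => -[i a] _.
have /eqP := psumr_eq0P ge0 sum0 (i := i) isT.
rewrite sqrf_eq0 => /eqP/(lnormi_eq0 A_neq0 rho_gt0)/(_ a) a0.
by rewrite /linform /local_row /= -/(pairing (val a - momentum rho i x0) b) a0 scale0r.
Qed.

Lemma newtS_at_zero : b = 0 -> newtS rho f x0 0 = 0.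
Proof.
move=> b0; have : synth (fun=> 1) = 0 by rewrite -[LHS]opprK b0 oppr0.
rewrite synth_one => /(congr1 (mulmx (newtDS rho f x0 0))).
by rewrite mulKVmx// mulmx0.
Qed.

Lemma newton_seq_stationary : b = 0 -> forall k, newton_seq rho f x0 k = x0.
Proof.
by move=> b0; elim=> [//|k IH]; rewrite /= IH subrr newton0 b0 addr0.
Qed.

End StationaryNewton.

(** (a) and (b) begin at index 1: at index 0 the factor is 1, whereas the distance from [x0] to
    [zeta] is only controlled by [r0 beta], with [r0 > 1] for [alpha > 0]. *)
Theorem theorem3p6p3 (R : realType) (n : nat) (n_gt0 : (0 < n)%N)
  (A : 'I_n -> {fset 'rV[R]_n}) (A_neq0 : forall i, A i != fset0)
  (rho : forall i, A i -> R) (rho_gt0 : forall i (a : A i), 0 < rho i a)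
  (f : system A) (f_neq0 : forall i, f i != 0)
  (alpha : R) (alpha_le : alpha <= (13 - 3 * Num.sqrt 17) / 4)
  (x0 : 'cV[R[i]]_n)
  (beta_fin : (beta rho f x0 < +oo)%E)
  (alpha_bound :
    ((2^-1)%:E * beta rho f x0 * mu rho f x0 * nu rho x0 <= alpha%:E)%E) :
  let r0 := (1 + alpha - Num.sqrt (1 - 6 * alpha + alpha ^+ 2)) / (4 * alpha) in
  let r1 :=
    (1 - 3 * alpha - Num.sqrt (1 - 6 * alpha + alpha ^+ 2)) / (4 * alpha) in
  let x := newton_seq rho f x0 in
  (forall k, newtDS rho f x0 (x k - x0) \in unitmx) /\
  exists zeta : 'cV[R[i]]_n,
    [/\ is_zero rho f zeta /\
        (fun k => toric_pi rho (x k)) @ \oo --> toric_pi rho zeta,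
        forall k, (1 <= k)%N ->
          ldist rho x0 (x k) zeta
            <= 2 / 2 ^+ (2 ^ k)%N * ldist rho x0 (x 1%N) x0,
        forall k, (1 <= k)%N ->
          ldist rho zeta (x k) zeta
            <= 2 / 2 ^+ (2 ^ k)%N * ldist rho x0 (x 1%N) x0,
        ((ldist rho x0 x0 zeta)%:E <= r0%:E * beta rho f x0)%E &
        ((ldist rho zeta (x 1%N) zeta)%:E <= r1%:E * beta rho f x0)%E].
Proof.
move=> r0 r1 x.
have D_unit : newtDS rho f x0 0 \in unitmx.
  by move: beta_fin; rewrite /beta; case: ifP.
have betaN := betaE A_neq0 rho_gt0 D_unit.
set b := - synthesis (local_synth rho f x0) (fun=> 1) in betaN.
set N := wnorm _ _ in betaN.
(* When [beta = 0], [alpha] may be 0, and [r0] and [r1] are then the default value of a division by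
   0; both multiply [beta = 0]. *)
have [N0|N_neq0] := eqVneq N 0.
  have b0 := first_step_eq0 A_neq0 rho_gt0 D_unit N0.
  have xE k : x k = x0 := newton_seq_stationary b0 k.
  split=> [k|]; first by rewrite xE subrr.
  exists x0; split.
  - split; last by under eq_fun do rewrite xE; exact: cvg_cst.
    rewrite -[x0]addr0; apply: (is_zero_newtS A_neq0 rho_gt0).
    exact: newtS_at_zero D_unit b0.
  - by move=> k _; rewrite !xE ldistxx// mulr0.
  - by move=> k _; rewrite !xE !ldistxx// mulr0.
  - by rewrite betaN N0 mule0 ldistxx.
  - by rewrite betaN N0 mule0 xE ldistxx.
have N_gt0 : 0 < N by rewrite lt_def N_neq0 wnorm_ge0.
have [M [V [muE nuE M1 V_gt0 bMV]]] :=
  invariants_finite A_neq0 rho_gt0 f_neq0 D_unit n_gt0 N_gt0 alpha_bound.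
have alpha_gt0 : 0 < alpha.
  rewrite -(pmulr_rgt0 _ (ltr0n R 2)); apply: lt_le_trans bMV.
  by rewrite !mulr_gt0// (lt_le_trans ltr01).
have sB := mu_bound A_neq0 rho_gt0 f_neq0 D_unit muE.
have lB := nu_bound A_neq0 rho_gt0 nuE.
have [u u_root u_le] := root_in_ball A_neq0 rho_gt0 D_unit sB lB
  alpha_gt0 alpha_le M1 V_gt0 N_gt0 bMV.
split=> [k|].
  exact: (newton_seq_unit A_neq0 rho_gt0 D_unit sB lB
    alpha_gt0 alpha_le M1 V_gt0 N_gt0 bMV u_root u_le).
have first := ldist_first A_neq0 rho_gt0 lB alpha_gt0 alpha_le M1 V_gt0 N_gt0 bMV.
exists (x0 + u); split.
- split.
    by apply: (is_zero_newtS A_neq0 rho_gt0); exact: newtS_eq0.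
  exact: (toric_seq_cvg A_neq0 rho_gt0 D_unit sB lB
    alpha_gt0 alpha_le M1 V_gt0 N_gt0 bMV u_root u_le).
- move=> k k1; rewrite first.
  exact: (ldist_x0_le A_neq0 rho_gt0 D_unit sB lB
    alpha_gt0 alpha_le M1 V_gt0 N_gt0 bMV u_root u_le).
- move=> k k1; rewrite first.
  exact: (ldist_zeta_le A_neq0 rho_gt0 D_unit sB lB
    alpha_gt0 alpha_le M1 V_gt0 N_gt0 bMV u_root u_le).
- rewrite betaN -EFinM lee_fin.
  exact: (ldist_x0_zeta_le A_neq0 rho_gt0 alpha_gt0 alpha_le N_gt0 u_le).
- rewrite betaN -EFinM lee_fin.
  exact: (ldist_zeta_first_le A_neq0 rho_gt0 D_unit sB lB
    alpha_gt0 alpha_le M1 V_gt0 N_gt0 bMV u_root u_le).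
Qed.
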